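(* Let $T$ be a tiling of $\mathbb{R}^2$, $G$ a group, $x_0\in\mathbb{R}^2$, and $t_1\le t_2\le\cdots$ radii with $t_n\to\infty$. Let $f_n:K_{t_{n+1}}\to K_{t_n}$ be the forgetful maps, which send $\pi_{t_{n+1}}(x_0)$ to $\pi_{t_n}(x_0)$. Let $f_n^*:\mathrm{Hom}(\pi_1(K_{t_n},\pi_{t_n}(x_0)),G)\to\mathrm{Hom}(\pi_1(K_{t_{n+1}},\pi_{t_{n+1}}(x_0)),G)$ be $\rho\mapsto\rho\circ(f_n)_*$. Then $$PREP_b(T)\;\cong\;\varinjlim_{f_n^*}\mathrm{Hom}(\pi_1(K_{t_n}),G).$$
   Context: Standing assumptions: $T$ has finite local complexity, and its hull $\Omega$ (closure of translates of $T$) is minimal. Each $K_t$ is path-connected, locally path-connected and semilocally simply connected. PE notions. For $x\in\mathbb{R}^2$ and $t>0$, $[B_t(x)]$ is the patch of tiles of $T$ meeting $B_t(x)$. Write $x\sim_t y$ iff $[B_t(x)]-x=[B_t(y)]-y$. - A PE open set with radius $t$ is an open set $U$ with $x\in U$, $x\sim_t y\Rightarrow y\in U$. - A function is PE with radius $t$ if it takes equal values at $\sim_t$-related points. - A flat PE principal $G$-bundle with radius $t$ is a principal $G$-bundle $\pi:P\to\mathbb{R}^2$ with local trivializations over a cover by PE open sets with radius $t$, whose transition functions $h_{ji}:U_i\cap U_j\to G$ are PE with radius $t$ and locally constant. - A based such bundle is a pair $(P,p_0)$ with $p_0\in\pi^{-1}(x_0)$. Based isomorphisms of radius $s$ are isomorphisms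 (with local expressions PE of radius $s$) sending base point to base point. - Two based bundles with radii $p,r$ are equivalent if they are based-isomorphic as bundles of some radius $s\ge p,r$. $PREP_b(T)$ is the set of equivalence classes of flat based PE principal $G$-bundles. Approximants. $E=\Omega\times\mathbb{R}^2$, and $(T',x)\sim_t(T'',y)$ iff $[B_t(x)]_{T'}-x=[B_t(y)]_{T''}-y$. $K_t=E/\sim_t$ (quotient topology), and $\pi_t(x)=[(T,x)]$. The forgetful map $K_{t'}\to K_t$ ($t'\ge t$) is induced by the identity of $E$. *)

(* Defs.v *)
From Stdlib Require Import Reals List.
Open Scope R_scope.

Definition set (X : Type) := X -> Prop.

Definition pt := (R * R)%type.
Definition padd (x y : pt) : pt := (fst x + fst y, snd x + snd y).
Definition dist (x y : pt) : R :=
  sqrt ((fst x - fst y) ^ 2 + (snd x - snd y) ^ 2).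
Definition origin : pt := (0, 0).

Definition openR2 (U : set pt) : Prop :=
  forall x, U x -> exists e, 0 < e /\ forall y, dist x y < e -> U y.

Definition interior (A : set pt) : set pt :=
  fun x => exists e, 0 < e /\ forall y, dist x y < e -> A y.

Definition is_tile (A : set pt) : Prop :=
  (exists x, interior A x) /\
  (forall x, (forall e, 0 < e -> exists y, A y /\ dist x y < e) -> A x) /\
  (exists M, forall y, A y -> dist y origin <= M) /\
  (forall x, A x -> forall e, 0 < e -> exists y, interior A y /\ dist x y < e).

Definition tiling_t := set (set pt).

Definition is_tiling (T : tiling_t) : Prop :=
  (forall A, T A -> is_tile A) /\
  (forall x, exists A, T A /\ A x) /\
  (forall A B, T A -> T B -> A <> B -> forall x, ~ (interior A x /\ interior B x)).

Definition shift (A : set pt) (v : pt) : set pt := fun y => A (padd y v).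
Definition shiftc (C : tiling_t) (v : pt) : tiling_t :=
  fun B => exists A, C A /\ B = shift A v.

Definition patch (T : tiling_t) (t : R) (x : pt) : tiling_t :=
  fun A => T A /\ exists y, A y /\ dist x y < t.

Definition FLC (T : tiling_t) : Prop :=
  forall r, 0 < r -> exists L : list tiling_t,
    forall x, exists P, In P L /\ exists v, patch T r x = shiftc P v.

Definition close (T1 T2 : tiling_t) (e : R) : Prop :=
  exists u v, dist u origin < e /\ dist v origin < e /\
    patch (shiftc T1 u) (/ e) origin = patch (shiftc T2 v) (/ e) origin.

Definition hull (T : tiling_t) (T' : tiling_t) : Prop :=
  forall e, 0 < e -> exists x, close T' (shiftc T x) e.

Definition minimal_hull (T : tiling_t) : Prop :=
  forall T' T'', hull T T' -> hull T T'' -> hull T' T''.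

(* E = Omega x R^2 and the approximants K_t = E / ~_t                  *)
Definition E := (tiling_t * pt)%type.

Definition simE (t : R) (a b : E) : Prop :=
  shiftc (patch (fst a) t (snd a)) (snd a) = shiftc (patch (fst b) t (snd b)) (snd b).

Section Approximants.
Variable T : tiling_t.

Definition openE (W : set E) : Prop :=
  forall a, hull T (fst a) -> W a ->
    exists e, 0 < e /\ forall T'' y, hull T T'' -> close (fst a) T'' e ->
      dist (snd a) y < e -> W (T'', y).

Definition cls (t : R) (a : E) : set E := fun b => hull T (fst b) /\ simE t a b.
Definition isK (t : R) (C : set E) : Prop := exists a, hull T (fst a) /\ C = cls t a.

Definition openK (t : R) (V : set (set E)) : Prop := openE (fun a => V (cls t a)).

Definition piK (t : R) (x : pt) : set E := cls t (T, x).

(* forgetful map K_{t'} -> K_t (t <= t'), induced by the identity of E *)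
Definition fgt (t : R) (C : set E) : set E :=
  fun b => exists a, C a /\ hull T (fst b) /\ simE t a b.

Definition I01 (s : R) : Prop := 0 <= s <= 1.

Definition contK (t : R) (g : R -> set E) : Prop :=
  forall V, openK t V -> forall s, I01 s -> V (g s) ->
    exists d, 0 < d /\ forall s', I01 s' -> Rabs (s' - s) < d -> V (g s').

Definition contK2 (t : R) (H : R -> R -> set E) : Prop :=
  forall V, openK t V -> forall u s, I01 u -> I01 s -> V (H u s) ->
    exists d, 0 < d /\ forall u' s', I01 u' -> I01 s' ->
      Rabs (u' - u) < d -> Rabs (s' - s) < d -> V (H u' s').

Definition pathK (t : R) (a b : set E) (g : R -> set E) : Prop :=
  (forall s, I01 s -> isK t (g s)) /\ contK t g /\ g 0 = a /\ g 1 = b.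

Definition loopK (t : R) (b : set E) (g : R -> set E) : Prop := pathK t b b g.

Definition homotopic (t : R) (b : set E) (g0 g1 : R -> set E) : Prop :=
  exists H : R -> R -> set E,
    (forall u s, I01 u -> I01 s -> isK t (H u s)) /\ contK2 t H /\
    (forall s, I01 s -> H 0 s = g0 s /\ H 1 s = g1 s) /\
    (forall u, I01 u -> H u 0 = b /\ H u 1 = b).

Definition concat (g0 g1 : R -> set E) : R -> set E :=
  fun s => if Rle_dec s (/ 2) then g0 (2 * s) else g1 (2 * s - 1).

Definition path_connectedK (t : R) : Prop :=
  forall a b, isK t a -> isK t b -> exists g, pathK t a b g.

Definition loc_path_connectedK (t : R) : Prop :=
  forall a V, isK t a -> openK t V -> V a ->
    exists W, openK t W /\ W a /\ (forall b, W b -> V b) /\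
      forall b c, isK t b -> isK t c -> W b -> W c ->
        exists g, pathK t b c g /\ forall s, I01 s -> W (g s).

Definition semiloc_simply_connectedK (t : R) : Prop :=
  forall a, isK t a -> exists V, openK t V /\ V a /\
    forall g, loopK t a g -> (forall s, I01 s -> V (g s)) ->
      homotopic t a g (fun _ => a).

End Approximants.

Record Group := {
  gcar :> Type;
  gmul : gcar -> gcar -> gcar;
  gone : gcar;
  ginv : gcar -> gcar;
  gassoc : forall a b c, gmul a (gmul b c) = gmul (gmul a b) c;
  gone_l : forall a, gmul gone a = a;
  gone_r : forall a, gmul a gone = a;
  ginv_l : forall a, gmul (ginv a) a = gone;
  ginv_r : forall a, gmul a (ginv a) = gone
}.

Section DirectLimit.
Variable G : Group.
Variable T : tiling_t.

(* rho : loops -> G, homotopy invariant and multiplicative for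
   concatenation: exactly a group homomorphism pi_1(K_t,b) -> G *)
Definition isHom (t : R) (b : set E) (rho : (R -> set E) -> G) : Prop :=
  (forall g0 g1, loopK T t b g0 -> loopK T t b g1 -> homotopic T t b g0 g1 ->
     rho g0 = rho g1) /\
  (forall g0 g1, loopK T t b g0 -> loopK T t b g1 ->
     rho (concat g0 g1) = gmul G (rho g0) (rho g1)).

Variable x0 : pt.
Variable tr : nat -> R.

Definition bpt (n : nat) : set E := piK T (tr n) x0.

Fixpoint fmap (n j : nat) (C : set E) : set E :=
  match j with
  | O => C
  | S j' => fmap n j' (fgt T (tr (n + j')) C)
  end.

Definition DLrep : Type :=
  { n : nat & { rho : (R -> set E) -> G | isHom (tr n) (bpt n) rho } }.

Definition dl_index (r : DLrep) : nat := projT1 r.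
Definition dl_hom (r : DLrep) : (R -> set E) -> G := proj1_sig (projT2 r).

Definition dl_equiv (r1 r2 : DLrep) : Prop :=
  exists k, (dl_index r1 <= k)%nat /\ (dl_index r2 <= k)%nat /\
    forall g, loopK T (tr k) (bpt k) g ->
      dl_hom r1 (fun s => fmap (dl_index r1) (k - dl_index r1) (g s)) =
      dl_hom r2 (fun s => fmap (dl_index r2) (k - dl_index r2) (g s)).

End DirectLimit.

Section Bundles.
Variable G : Group.
Variable T : tiling_t.

Definition simR (t : R) (x y : pt) : Prop := simE t (T, x) (T, y).

Definition PE_open (t : R) (U : set pt) : Prop :=
  openR2 U /\ forall x y, U x -> simR t x y -> U y.

(* open subsets of R^2 x G, G discrete *)
Definition openPG (Z : set (pt * G)) : Prop := forall g, openR2 (fun x => Z (x, g)).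

Record FlatPEBundle (t : R) := {
  tot : Type;
  opn : set tot -> Prop;
  proj : tot -> pt;
  act : tot -> G -> tot;
  Idx : Type;
  cov : Idx -> set pt;
  triv : Idx -> tot -> G;
  opn_T : opn (fun _ => True);
  opn_U : forall F : set (set tot), (forall W, F W -> opn W) ->
            opn (fun p => exists W, F W /\ W p);
  opn_I : forall W1 W2, opn W1 -> opn W2 -> opn (fun p => W1 p /\ W2 p);
  act_one : forall p, act p (gone G) = p;
  act_mul : forall p g h, act (act p g) h = act p (gmul G g h);
  proj_act : forall p g, proj (act p g) = proj p;
  act_cont : forall g W, opn W -> opn (fun p => W (act p g));
  proj_cont : forall U, openR2 U -> opn (fun p => U (proj p));
  t_pos : 0 < t;
  cov_PE : forall i, PE_open t (cov i);
  cov_all : forall x, exists i, cov i x;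
  (* local trivializations p |-> (proj p, triv i p) :
     equivariant homeomorphisms pi^-1(U_i) -> U_i x G *)
  triv_eqv : forall i p g, cov i (proj p) -> triv i (act p g) = gmul G (triv i p) g;
  triv_bij : forall i x g, cov i x ->
      exists p, proj p = x /\ triv i p = g /\
        forall q, proj q = x -> triv i q = g -> q = p;
  triv_homeo : forall i (W : set tot), (forall p, W p -> cov i (proj p)) ->
      (opn W <-> openPG (fun xg => exists p, W p /\ proj p = fst xg /\ triv i p = snd xg));
  trans : exists h : Idx -> Idx -> pt -> G,
      (forall i j p, cov i (proj p) -> cov j (proj p) ->
         triv j p = gmul G (h j i (proj p)) (triv i p)) /\
      (forall i j x y, cov i x -> cov j x -> cov i y -> cov j y -> simR t x y ->
         h j i x = h j i y) /\
      (forall i j x, cov i x -> cov j x -> exists e, 0 < e /\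
         forall y, cov i y -> cov j y -> dist x y < e -> h j i y = h j i x)
}.

Arguments tot {t}. Arguments opn {t}. Arguments proj {t}. Arguments act {t}.
Arguments Idx {t}. Arguments cov {t}. Arguments triv {t}.

Variable x0 : pt.

Record BasedBundle := {
  brad : R;
  bbun : FlatPEBundle brad;
  bpt0 : tot bbun;
  bpt0_fib : proj bbun bpt0 = x0
}.

Definition based_iso (s : R) (B1 B2 : BasedBundle) : Prop :=
  exists phi : tot (bbun B1) -> tot (bbun B2),
    (forall p, proj (bbun B2) (phi p) = proj (bbun B1) p) /\
    (forall p g, phi (act (bbun B1) p g) = act (bbun B2) (phi p) g) /\
    (forall p q, phi p = phi q -> p = q) /\
    (forall q, exists p, phi p = q) /\
    (forall W, opn (bbun B1) W <-> opn (bbun B2) (fun q => exists p, W p /\ phi p = q)) /\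
    phi (bpt0 B1) = bpt0 B2 /\
    (* local expressions x |-> triv'_k(phi p) triv_i(p)^-1 are PE of radius s *)
    (forall i k p q,
       cov (bbun B1) i (proj (bbun B1) p) -> cov (bbun B2) k (proj (bbun B1) p) ->
       cov (bbun B1) i (proj (bbun B1) q) -> cov (bbun B2) k (proj (bbun B1) q) ->
       simR s (proj (bbun B1) p) (proj (bbun B1) q) ->
       gmul G (triv (bbun B2) k (phi p)) (ginv G (triv (bbun B1) i p)) =
       gmul G (triv (bbun B2) k (phi q)) (ginv G (triv (bbun B1) i q))).

Definition bundle_equiv (B1 B2 : BasedBundle) : Prop :=
  exists s, brad B1 <= s /\ brad B2 <= s /\ based_iso s B1 B2.

End Bundles.

(* Main.v *)
(* Every patch of a tiling of the hull occurs in T, so K_t is the quotient of R^2 by ~_t, with the quotient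
   topology. A flat PE bundle with radius r is therefore a principal G-covering of K_t for each t >= r: PE open
   sets are the open sets of K_t, and locally constant PE functions are the locally constant functions on K_t.
   Paths of K_t lift to such a covering, and the holonomy of a based one is a homomorphism from the fundamental
   group of K_t to G, compatible with the forgetful maps. An isomorphism of radius s preserves the holonomy on
   K_t for t >= s; conversely, if two holonomies agree on K_t, then transport along paths from the base point
   is an isomorphism of radius t. Finally rho is the holonomy of the bundle over R^2 whose chart around a point a
   of K_t compares, by rho, a path to C through a with a chosen path to C: the choice of the path inside a small
   neighbourhood of a does not matter because K_t is semilocally simply connected. *)
From Stdlib Require Import Reals Lra Lia Rgeom.
From Stdlib Require Import Classical ClassicalEpsilon FunctionalExtensionality PropExtensionality.
Require Import Defs.
Open Scope R_scope.

(** * The approximants as quotients of the plane *)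

(** Points of a bundle over distinct but related points of the plane lie in different fibres,
    although they may represent one point of the covering of K_t. That covering is never formed:
    lifts take values in the total space over the plane, where they may jump between related points,
    and equality is weakened to equality of chart values over one point of K_t. A representative
    over a prescribed point of the plane is picked only when an isomorphism is built. The plane is
    simply connected, so the information in a flat PE bundle lies in the radius of its charts and
    not in its topology over the plane. This is why the bundle of a representation can have
    transition functions that form a coboundary: its potentials involve an arbitrary path to each
    point of K_t and may jump, while their quotients are PE and locally constant. Semilocal simple
    connectedness contracts only loops at the centre of a neighbourhood, so each chart of that
    bundle remembers a centre through which its paths run. *)

Lemma set_ext (X : Type) (A B : set X) : (forall x, A x <-> B x) -> A = B.
Proof.
  intro H; apply functional_extensionality; intro x.
  apply propositional_extensionality, H.
Qed.

Definition psub (x y : pt) : pt := (fst x - fst y, snd x - snd y).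
Definition norm (x : pt) : R := dist x origin.

Lemma pt_eq (x y : pt) : fst x = fst y -> snd x = snd y -> x = y.
Proof. destruct x, y; simpl; intros; subst; reflexivity. Qed.

Ltac pt_ring := apply pt_eq; unfold padd, psub, origin; simpl; ring.

Lemma dist_euc_dist (x y : pt) : dist x y = dist_euc (fst x) (snd x) (fst y) (snd y).
Proof. unfold dist, dist_euc, Rsqr; f_equal; ring. Qed.

Lemma dist_triangle (x y z : pt) : dist x y <= dist x z + dist z y.
Proof. rewrite !dist_euc_dist; apply triangle. Qed.

Lemma dist_symm (x y : pt) : dist x y = dist y x.
Proof. unfold dist; f_equal; ring. Qed.

Lemma dist_refl (x : pt) : dist x x = 0.
Proof. unfold dist; rewrite <- sqrt_0; f_equal; ring. Qed.

Lemma dist_norm (x y : pt) : dist x y = norm (psub x y).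
Proof. unfold norm, dist, psub, origin; f_equal; simpl; ring. Qed.

Lemma norm_padd (x y : pt) : norm (padd x y) <= norm x + norm y.
Proof.
  unfold norm; eapply Rle_trans; [apply (dist_triangle _ _ y) |].
  apply Rplus_le_compat_r, Req_le; rewrite dist_norm; unfold norm; f_equal.
  pt_ring.
Qed.

Lemma norm_psub (x y : pt) : norm (psub x y) <= norm x + norm y.
Proof.
  rewrite <- dist_norm; eapply Rle_trans; [apply (dist_triangle _ _ origin) |].
  unfold norm; rewrite (dist_symm origin y); lra.
Qed.

Lemma norm_ge0 (x : pt) : 0 <= norm x.
Proof. apply sqrt_pos. Qed.

Lemma openR2_inter (U V : set pt) :
  openR2 U -> openR2 V -> openR2 (fun x => U x /\ V x).
Proof.
  intros HU HV x [Ux Vx].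
  destruct (HU x Ux) as [e [He H]], (HV x Vx) as [f [Hf H']].
  exists (Rmin e f); split; [apply Rmin_glb_lt; lra |].
  intros y Hy; split; [apply H | apply H']; pose proof (Rmin_l e f); pose proof (Rmin_r e f); lra.
Qed.

Lemma shift_shift (A : set pt) (u v : pt) : shift (shift A u) v = shift A (padd u v).
Proof.
  unfold shift; apply functional_extensionality; intro y; f_equal; pt_ring.
Qed.

Lemma shiftc_shiftc (C : tiling_t) (u v : pt) :
  shiftc (shiftc C u) v = shiftc C (padd u v).
Proof.
  apply set_ext; intro B; unfold shiftc; split.
  - intros [A [[A' [HA' ->]] ->]]; exists A'; rewrite shift_shift; auto.
  - intros [A [HA ->]]; exists (shift A u); rewrite shift_shift; eauto.
Qed.

Lemma shiftc_origin (C : tiling_t) : shiftc C origin = C.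
Proof.
  assert (H : forall A : set pt, shift A origin = A).
  { intro A; apply functional_extensionality; intro y; unfold shift; f_equal; pt_ring. }
  apply set_ext; intro B; split.
  - intros [A [HA ->]]; rewrite H; exact HA.
  - intro HB; exists B; rewrite H; auto.
Qed.

Lemma shiftc_patch (S : tiling_t) (t : R) (x : pt) :
  shiftc (patch S t x) x = patch (shiftc S x) t origin.
Proof.
  apply set_ext; intro B; split.
  - intros [A [[HA [y [Ay Hy]]] ->]]; split; [exists A; auto |].
    exists (psub y x); split.
    + unfold shift; replace (padd (psub y x) x) with y by pt_ring; exact Ay.
    + rewrite dist_symm; change (norm (psub y x) < t); rewrite <- dist_norm, dist_symm; exact Hy.
  - intros [[A [HA ->]] [y [Ay Hy]]]; exists A; split; [| reflexivity].
    split; [exact HA |]; exists (padd y x); split; [exact Ay |].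
    rewrite dist_symm, dist_norm; replace (psub (padd y x) x) with y by pt_ring.
    rewrite dist_symm in Hy; exact Hy.
Qed.

Lemma simE_patch (t : R) (a b : E) :
  simE t a b <->
  patch (shiftc (fst a) (snd a)) t origin = patch (shiftc (fst b) (snd b)) t origin.
Proof. unfold simE; rewrite !shiftc_patch; tauto. Qed.

Lemma simE_refl (t : R) (a : E) : simE t a a.
Proof. reflexivity. Qed.

Lemma simE_sym (t : R) (a b : E) : simE t a b -> simE t b a.
Proof. unfold simE; auto. Qed.

Lemma simE_trans (t : R) (a b c : E) : simE t a b -> simE t b c -> simE t a c.
Proof. unfold simE; congruence. Qed.

(** By the triangle inequality, a tile meeting the ball of radius [t] about [w] meets the ball of
    radius [norm w + t] about the origin, hence belongs to the common patch. *)
Lemma patch_shift_incl (S S' : tiling_t) (r t : R) (w : pt) :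
  patch S r origin = patch S' r origin -> norm w + t <= r ->
  forall B, patch (shiftc S w) t origin B -> patch (shiftc S' w) t origin B.
Proof.
  intros H Hr B [[A [HA ->]] [y [Ay Hy]]].
  assert (HA' : patch S' r origin A).
  { rewrite <- H; split; [exact HA |]; exists (padd y w); split; [exact Ay |].
    rewrite dist_symm in Hy |- *; change (norm (padd y w) < r); change (norm y < t) in Hy.
    pose proof (norm_padd y w); lra. }
  split; [exists A; split; [apply HA' | reflexivity] | eauto].
Qed.

Lemma patch_shift (S S' : tiling_t) (r t : R) (w : pt) :
  patch S r origin = patch S' r origin -> norm w + t <= r ->
  patch (shiftc S w) t origin = patch (shiftc S' w) t origin.
Proof.
  intros H Hr; apply set_ext; intro B; split;
    (eapply patch_shift_incl; [| exact Hr]); auto.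
Qed.

Lemma simE_mono (t t' : R) (a b : E) : t <= t' -> simE t' a b -> simE t a b.
Proof.
  rewrite !simE_patch; intros Ht H.
  rewrite <- (shiftc_origin (shiftc (fst a) _)), <- (shiftc_origin (shiftc (fst b) _)).
  apply (patch_shift _ _ t'); [exact H |]; unfold norm; rewrite dist_refl; lra.
Qed.

(** The displacement [psub u v] depends on neither [t] nor [x]: within the range of agreement all
    points are moved by one vector. *)
Lemma close_simE (T1 T2 : tiling_t) (e : R) : close T1 T2 e ->
  exists u v, norm u < e /\ norm v < e /\
    forall t x, norm (psub x v) + t <= / e ->
      simE t (T2, x) (T1, padd x (psub u v)).
Proof.
  intros [u [v [Hu [Hv H]]]]; exists u, v; split; [exact Hu |]; split; [exact Hv |].
  intros t x Hx; rewrite simE_patch; simpl.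
  pose proof (patch_shift _ _ _ t (psub x v) (eq_sym H) Hx) as H'.
  rewrite !shiftc_shiftc in H'.
  replace (padd v (psub x v)) with x in H' by pt_ring.
  replace (padd u (psub x v)) with (padd x (psub u v)) in H' by pt_ring.
  exact H'.
Qed.

Lemma close_refl (S : tiling_t) (e : R) : 0 < e -> close S S e.
Proof. intro He; exists origin, origin; rewrite !dist_refl; auto. Qed.

Section Approximant.
Variable T : tiling_t.

Lemma hull_self : hull T T.
Proof. intros e He; exists origin; rewrite shiftc_origin; apply close_refl, He. Qed.

Lemma cls_eq (t : R) (a b : E) : simE t a b -> cls T t a = cls T t b.
Proof.
  intro H; apply set_ext; intro c; unfold cls; split; intros [Hc Hs]; split; auto.
  - eapply simE_trans; [apply simE_sym, H | exact Hs].
  - eapply simE_trans; [exact H | exact Hs].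
Qed.

Lemma piK_eq (t : R) (x y : pt) : piK T t x = piK T t y <-> simR T t x y.
Proof.
  split; [| apply cls_eq].
  intro H; assert (Hy : cls T t (T, x) (T, y)).
  { change (piK T t x (T, y)); rewrite H; split; [apply hull_self | apply simE_refl]. }
  apply Hy.
Qed.

Lemma isK_piK (t : R) (x : pt) : isK T t (piK T t x).
Proof. exists (T, x); split; [apply hull_self | reflexivity]. Qed.

(** [T'] agrees up to a small motion with a translate of [T] on a large ball. One [w] serves the
    whole unit ball, so that [openR2_openK] can vary the point while keeping [w]. *)
Lemma hull_local (t : R) (T' : tiling_t) (x : pt) : hull T T' ->
  exists w, forall y, dist x y <= 1 -> simE t (T', y) (T, padd y w).
Proof.
  (* The agreement must cover [norm y + norm v + t], where [norm y] is at most [norm x + 1] and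
     [norm v] at most 1; the constant 3 also keeps [M] away from 0. *)
  intro HT'; set (M := norm x + Rabs t + 3).
  assert (HM : 3 <= M) by (unfold M; pose proof (norm_ge0 x); pose proof (Rabs_pos t); lra).
  assert (He : 0 < / M) by (apply Rinv_0_lt_compat; lra).
  assert (He1 : / M <= 1) by (rewrite <- Rinv_1; apply Rinv_le_contravar; lra).
  destruct (HT' (/ M) He) as [z Hz].
  assert (Hz' : close (shiftc T z) T' (/ M)).
  { destruct Hz as [u [v [Hu [Hv H]]]]; exists v, u; auto. }
  destruct (close_simE _ _ _ Hz') as [u [v [Hu [Hv H]]]].
  exists (padd z (psub u v)); intros y Hy; eapply simE_trans; [apply H |].
  - rewrite Rinv_inv; unfold M.
    pose proof (norm_psub y v); pose proof (Rle_abs t).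
    assert (norm y <= norm x + 1).
    { unfold norm; pose proof (dist_triangle y origin x); rewrite (dist_symm y x) in H2; lra. }
    lra.
  - rewrite simE_patch; simpl; rewrite shiftc_shiftc; f_equal; f_equal; pt_ring.
Qed.

Lemma isK_point (t : R) (C : set E) : isK T t C -> exists x, C = piK T t x.
Proof.
  intros [[T' x] [HT' ->]]; destruct (hull_local t T' x HT') as [w Hw].
  exists (padd x w); apply cls_eq, Hw; rewrite dist_refl; lra.
Qed.

(* With [isK_point] and [openR2_openK]: K_t is the topological quotient of R^2 by [simR], so that its open
   sets are the PE open sets. *)
Lemma openK_openR2 (t : R) (V : set (set E)) :
  openK T t V -> openR2 (fun x => V (piK T t x)).
Proof.
  intros HV x Hx; destruct (HV (T, x) hull_self Hx) as [e [He H]].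
  exists e; split; [exact He |]; intros y Hy; apply (H T y hull_self); auto.
  apply close_refl, He.
Qed.

Lemma openR2_openK (t : R) (V : set (set E)) :
  openR2 (fun x => V (piK T t x)) -> openK T t V.
Proof.
  intros HV [T' x] HT' Hx; simpl in *; destruct (hull_local t T' x HT') as [w Hw].
  assert (Hxw : V (piK T t (padd x w))).
  { unfold piK; rewrite <- (cls_eq t (T', x)); [exact Hx |].
    apply Hw; rewrite dist_refl; lra. }
  destruct (HV _ Hxw) as [e1 [He1 H1]].
  (* The extra [3 * / e1] gives [3 * / M <= e1]: the point moves by at most the distance to [y] plus
     the norms of [u] and [v], each below [/ M]. *)
  set (M := norm x + Rabs t + 3 + 3 * / e1).
  assert (Hi : 0 < / e1) by (apply Rinv_0_lt_compat; lra).
  assert (HM : 3 <= M) by (unfold M; pose proof (norm_ge0 x); pose proof (Rabs_pos t); lra).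
  assert (He : 0 < / M) by (apply Rinv_0_lt_compat; lra).
  assert (He3 : / M <= / 3) by (apply Rinv_le_contravar; lra).
  assert (He2 : 3 * / M <= e1).
  { apply Rmult_le_reg_r with M; [lra |]; rewrite Rmult_assoc, Rinv_l by lra.
    apply Rle_trans with (e1 * (3 * / e1)); [right; field; lra |].
    apply Rmult_le_compat_l; [lra |]; unfold M.
    pose proof (norm_ge0 x); pose proof (Rabs_pos t); lra. }
  exists (/ M); split; [exact He |]; intros T'' y HT'' Hc Hy.
  destruct (close_simE _ _ _ Hc) as [u [v [Hu [Hv H]]]].
  assert (Hxy : dist x (padd y (psub u v)) <= dist x y + norm u + norm v).
  { pose proof (dist_triangle x (padd y (psub u v)) y).
    assert (dist y (padd y (psub u v)) = norm (psub v u)).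
    { rewrite dist_norm; f_equal; pt_ring. }
    pose proof (norm_psub v u); lra. }
  assert (Hsim : simE t (T'', y) (T, padd (padd y (psub u v)) w)).
  { eapply simE_trans; [apply H | apply Hw; lra].
    rewrite Rinv_inv; unfold M.
    pose proof (norm_psub y v); pose proof (Rle_abs t).
    assert (norm y <= norm x + 1).
    { unfold norm; pose proof (dist_triangle y origin x); rewrite (dist_symm y x) in H3; lra. }
    lra. }
  rewrite (cls_eq t _ _ Hsim); apply H1.
  replace (dist (padd x w) (padd (padd y (psub u v)) w)) with (dist x (padd y (psub u v)));
    [lra |].
  rewrite !dist_norm; f_equal; pt_ring.
Qed.

Lemma openK_inter (t : R) (V W : set (set E)) :
  openK T t V -> openK T t W -> openK T t (fun C => V C /\ W C).
Proof.
  intros HV HW; apply openR2_openK.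
  apply (openR2_inter (fun x => V (piK T t x)) (fun x => W (piK T t x)));
    apply openK_openR2; assumption.
Qed.

Lemma fgt_cls (t t' : R) (a : E) : t <= t' -> hull T (fst a) ->
  fgt T t (cls T t' a) = cls T t a.
Proof.
  intros Ht Ha; apply set_ext; intro b; split.
  - intros [c [[Hc Hac] [Hb Hcb]]]; split; [exact Hb |].
    eapply simE_trans; [| exact Hcb]; apply (simE_mono _ t'); auto.
  - intros [Hb Hab]; exists a; split; [split; [exact Ha | apply simE_refl] | auto].
Qed.

Section Forgetful.
Variable tr : nat -> R.
Hypothesis Hmono : forall n, tr n <= tr (S n).

Lemma fmap_cls (n j : nat) (a : E) : hull T (fst a) ->
  fmap T tr n j (cls T (tr (n + j)) a) = cls T (tr n) a.
Proof.
  intro Ha; induction j as [| j IH]; simpl.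
  - rewrite PeanoNat.Nat.add_0_r; reflexivity.
  - rewrite fgt_cls; [exact IH | | exact Ha].
    rewrite PeanoNat.Nat.add_succ_r; apply Hmono.
Qed.

Lemma radii_le (n k : nat) : (n <= k)%nat -> tr n <= tr k.
Proof. induction 1; [lra |]; eapply Rle_trans; eauto. Qed.

Lemma fmap_piK (n k : nat) (x : pt) : (n <= k)%nat ->
  fmap T tr n (k - n) (piK T (tr k) x) = piK T (tr n) x.
Proof.
  intro H; replace k with (n + (k - n))%nat at 2 by lia.
  apply fmap_cls, hull_self.
Qed.

(** Continuity is tested in the plane: by [fmap_piK], an open set at level [n] and its preimage at
    level [k] pull back to the same subset of the plane. *)
Lemma fmap_path (n k : nat) (a b : set E) (g : R -> set E) : (n <= k)%nat ->
  pathK T (tr k) a b g ->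
  pathK T (tr n) (fmap T tr n (k - n) a) (fmap T tr n (k - n) b)
    (fun s => fmap T tr n (k - n) (g s)).
Proof.
  intros H [HK [Hc [H0 H1]]]; repeat split; try congruence.
  - intros s Hs; destruct (isK_point _ _ (HK s Hs)) as [x ->].
    rewrite fmap_piK by exact H; apply isK_piK.
  - intros V HV s Hs Hg; apply (Hc (fun C => V (fmap T tr n (k - n) C))); auto.
    apply openR2_openK; intros x Hx; rewrite fmap_piK in Hx by exact H.
    destruct (openK_openR2 _ _ HV x Hx) as [e [He HH]]; exists e; split; [exact He |].
    intros y Hy; rewrite fmap_piK by exact H; auto.
Qed.
End Forgetful.
End Approximant.

(** * Paths and homotopies *)

Lemma I01_connected_from_0 (A : R -> Prop) :
  (forall s, I01 s -> exists d, 0 < d /\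
     forall s', I01 s' -> Rabs (s' - s) < d -> (A s <-> A s')) ->
  A 0 -> forall s, I01 s -> A s.
Proof.
  intros Hloc H0.
  set (P := fun s => I01 s /\ forall r, 0 <= r <= s -> A r).
  assert (HP0 : P 0).
  { split; [split; lra |]; intros r Hr; replace r with 0 by lra; exact H0. }
  destruct (completeness P) as [m [Hub Hlub]].
  { exists 1; intros s [[_ Hs] _]; exact Hs. }
  { exists 0; exact HP0. }
  assert (Hm : I01 m).
  { split; [apply Hub, HP0 | apply Hlub; intros s [[_ Hs] _]; exact Hs]. }
  destruct (Hloc m Hm) as [d [Hd Hc]].
  assert (Hex : exists s, P s /\ m - d < s).
  { apply NNPP; intro Hn; assert (m <= m - d); [| lra].
    apply Hlub; intros s Hs; apply Rnot_lt_le; intro Hlt; apply Hn; eauto. }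
  destruct Hex as [s [[Hs HAs] Hsm]].
  assert (Hle : s <= m) by (apply Hub; split; assumption).
  assert (HAm : A m).
  { apply (Hc s Hs); [unfold Rabs; destruct Rcase_abs; lra |]; apply HAs; split; [apply Hs | lra]. }
  (* Passing the supremum [m] by [d / 2] is possible unless 1 is reached first, so [m = 1]. *)
  assert (Hall : P (Rmin 1 (m + d / 2))).
  { split; [unfold I01, Rmin; destruct Rle_dec; destruct Hm; lra |].
    intros r Hr; destruct (Rle_dec r s) as [Hrs | Hrs]; [apply HAs; lra |].
    destruct Hs; unfold Rmin in Hr; apply (Hc r); auto.
    - unfold I01; destruct Rle_dec; lra.
    - unfold Rabs; destruct Rcase_abs, Rle_dec; lra. }
  assert (Hm1 : m = 1).
  { pose proof (Hub _ Hall) as HU; destruct Hm; unfold Rmin in HU; destruct Rle_dec; lra. }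
  intros r Hr; destruct Hall as [_ Hall]; apply Hall.
  subst m; destruct Hr; unfold Rmin; destruct Rle_dec; lra.
Qed.

(** A locally constant property of the interval is constant. This takes the place of compactness and
    Lebesgue numbers in lifting paths and homotopies. *)
Lemma I01_connected (A : R -> Prop) :
  (forall s, I01 s -> exists d, 0 < d /\
     forall s', I01 s' -> Rabs (s' - s) < d -> (A s <-> A s')) ->
  forall r s, I01 r -> I01 s -> A r -> A s.
Proof.
  intros H r s Hr Hs HA; destruct (classic (A 0)) as [H0 | H0].
  - apply I01_connected_from_0; auto.
  - exfalso; apply (I01_connected_from_0 (fun s => ~ A s)) with r; auto.
    intros s' Hs'; destruct (H s' Hs') as [d [Hd Hc]]; exists d; split; [exact Hd |].
    intros s'' Hs'' Hd''; specialize (Hc s'' Hs'' Hd''); tauto.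
Qed.

Lemma I01_0 : I01 0. Proof. split; lra. Qed.
Lemma I01_1 : I01 1. Proof. split; lra. Qed.
Lemma I01_half : I01 (/ 2). Proof. split; lra. Qed.
Lemma I01_mult (r s : R) : I01 r -> I01 s -> I01 (r * s).
Proof.
  intros [Hr0 Hr1] [Hs0 Hs1]; split; [apply Rmult_le_pos; lra |].
  rewrite <- (Rmult_1_r 1); apply Rmult_le_compat; lra.
Qed.

#[export] Hint Resolve I01_0 I01_1 I01_half : core.

Lemma Rabs_lt_iff (x d : R) : Rabs x < d <-> - d < x < d.
Proof. split; [intro H; apply Rabs_def2 in H; lra | intros [H1 H2]; apply Rabs_def1; assumption]. Qed.

Definition rev_path (g : R -> set E) : R -> set E := fun s => g (1 - s).
Definition const_path (C : set E) : R -> set E := fun _ => C.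

Lemma concat_l (g h : R -> set E) (s : R) : s <= / 2 -> concat g h s = g (2 * s).
Proof. intro Hs; unfold concat; destruct Rle_dec; [reflexivity | lra]. Qed.

Lemma concat_r (g h : R -> set E) (s : R) : g 1 = h 0 -> / 2 <= s ->
  concat g h s = h (2 * s - 1).
Proof.
  intros Hgh Hs; unfold concat; destruct Rle_dec; [| reflexivity].
  replace (2 * s) with 1 by lra; rewrite Hgh; f_equal; lra.
Qed.

Lemma concat_0 (g h : R -> set E) : concat g h 0 = g 0.
Proof. rewrite concat_l by lra; f_equal; ring. Qed.

Lemma concat_1 (g h : R -> set E) : concat g h 1 = h 1.
Proof. unfold concat; destruct Rle_dec; [lra |]; f_equal; ring. Qed.

Lemma rev_path_0 (g : R -> set E) : rev_path g 0 = g 1.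
Proof. unfold rev_path; f_equal; ring. Qed.

Lemma rev_path_1 (g : R -> set E) : rev_path g 1 = g 0.
Proof. unfold rev_path; f_equal; ring. Qed.

(** Lipschitz rather than merely continuous: piecewise affine maps satisfy it by arithmetic, and
    interpolating two such maps gives a Lipschitz map of both variables. *)
Definition reparam (phi : R -> R) : Prop :=
  (forall s, I01 s -> I01 (phi s)) /\
  exists K, 0 < K /\ forall r s, I01 r -> I01 s -> Rabs (phi r - phi s) <= K * Rabs (r - s).

Section Paths.
Variables (T : tiling_t) (t : R).

(** A homotopy without end conditions. A path is a constant family, so concatenation and reversal
    are proved once for paths and homotopies. *)
Definition family (H : R -> R -> set E) : Prop :=
  (forall u s, I01 u -> I01 s -> isK T t (H u s)) /\ contK2 T t H.

Lemma contK_ext (g h : R -> set E) :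
  (forall s, I01 s -> g s = h s) -> contK T t g -> contK T t h.
Proof.
  intros He Hg V HV s Hs Hh; rewrite <- He in Hh by exact Hs.
  destruct (Hg V HV s Hs Hh) as [d [Hd H]]; exists d; split; [exact Hd |].
  intros s' Hs' Hd'; rewrite <- He by exact Hs'; auto.
Qed.

Lemma pathK_ext (a b : set E) (g h : R -> set E) :
  (forall s, I01 s -> g s = h s) -> pathK T t a b g -> pathK T t a b h.
Proof.
  intros He [HK [Hc [H0 H1]]]; split; [intros s Hs; rewrite <- He; auto |].
  split; [apply (contK_ext g); auto | rewrite <- !He; auto].
Qed.

Lemma pathK_isK_l (a b : set E) (g : R -> set E) : pathK T t a b g -> isK T t a.
Proof. intros [HK [_ [<- _]]]; auto. Qed.

Lemma pathK_isK_r (a b : set E) (g : R -> set E) : pathK T t a b g -> isK T t b.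
Proof. intros [HK [_ [_ <-]]]; auto. Qed.

Lemma family_path (H : R -> R -> set E) (a b : set E) (u : R) :
  family H -> I01 u -> H u 0 = a -> H u 1 = b -> pathK T t a b (H u).
Proof.
  intros [HK Hc] Hu H0 H1; repeat split; auto.
  intros V HV s Hs HVs; destruct (Hc V HV u s Hu Hs HVs) as [d [Hd HH]].
  exists d; split; [exact Hd |]; intros s' Hs' Hd'; apply HH; auto.
  rewrite Rminus_diag, Rabs_R0; exact Hd.
Qed.

Lemma path_family (a b : set E) (g : R -> set E) :
  pathK T t a b g -> family (fun _ => g).
Proof.
  intros [HK [Hc _]]; split; [auto |]; intros V HV u s Hu Hs HVs.
  destruct (Hc V HV s Hs HVs) as [d [Hd HH]]; exists d; split; auto.
Qed.

Lemma family_concat (H0 H1 : R -> R -> set E) :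
  family H0 -> family H1 -> (forall u, I01 u -> H0 u 1 = H1 u 0) ->
  family (fun u => concat (H0 u) (H1 u)).
Proof.
  intros [HK0 Hc0] [HK1 Hc1] Hglue; split.
  - intros u s Hu [Hs0 Hs1]; unfold concat; destruct Rle_dec; [apply HK0 | apply HK1]; auto;
      split; lra.
  - intros V HV u s Hu [Hs0 Hs1] HVs.
    assert (HL : s <= / 2 -> exists d, 0 < d /\ forall u' s', I01 u' -> I01 s' ->
      Rabs (u' - u) < d -> Rabs (s' - s) < d -> s' <= / 2 -> V (concat (H0 u') (H1 u') s')).
    { intro Hs; rewrite concat_l in HVs by exact Hs.
      destruct (Hc0 V HV u (2 * s)) as [d [Hd HH]]; auto; [split; lra |].
      exists (d / 2); split; [lra |]; intros u' s' Hu' [Hs'0 Hs'1].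
      rewrite !Rabs_lt_iff; intros Hu'd Hs'd Hs'.
      rewrite concat_l by exact Hs'; apply HH; auto; [split | apply Rabs_lt_iff ..]; lra. }
    assert (HR : / 2 <= s -> exists d, 0 < d /\ forall u' s', I01 u' -> I01 s' ->
      Rabs (u' - u) < d -> Rabs (s' - s) < d -> / 2 <= s' -> V (concat (H0 u') (H1 u') s')).
    { intro Hs; rewrite concat_r in HVs by auto.
      destruct (Hc1 V HV u (2 * s - 1)) as [d [Hd HH]]; auto; [split; lra |].
      exists (d / 2); split; [lra |]; intros u' s' Hu' [Hs'0 Hs'1].
      rewrite !Rabs_lt_iff; intros Hu'd Hs'd Hs'.
      rewrite concat_r by auto; apply HH; auto; [split | apply Rabs_lt_iff ..]; lra. }
    destruct (Rtotal_order s (/ 2)) as [Hs | [Hs | Hs]].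
    + destruct HL as [d [Hd HH]]; [lra |].
      exists (Rmin d (/ 2 - s)); split; [apply Rmin_glb_lt; lra |].
      pose proof (Rmin_l d (/ 2 - s)); pose proof (Rmin_r d (/ 2 - s)).
      intros u' s' Hu' Hs'; rewrite !Rabs_lt_iff; intros.
      apply HH; auto; rewrite ?Rabs_lt_iff; lra.
    + destruct HL as [d [Hd HH]]; [lra |]; destruct HR as [d' [Hd' HH']]; [lra |].
      exists (Rmin d d'); split; [apply Rmin_glb_lt; lra |].
      pose proof (Rmin_l d d'); pose proof (Rmin_r d d').
      intros u' s' Hu' Hs' ? ?; destruct (Rle_dec s' (/ 2)).
      * apply HH; auto; lra.
      * apply HH'; auto; lra.
    + destruct HR as [d [Hd HH]]; [lra |].
      exists (Rmin d (s - / 2)); split; [apply Rmin_glb_lt; lra |].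
      pose proof (Rmin_l d (s - / 2)); pose proof (Rmin_r d (s - / 2)).
      intros u' s' Hu' Hs'; rewrite !Rabs_lt_iff; intros.
      apply HH; auto; rewrite ?Rabs_lt_iff; lra.
Qed.

Lemma family_rev (H : R -> R -> set E) : family H -> family (fun u => rev_path (H u)).
Proof.
  intros [HK Hc]; unfold rev_path; split.
  - intros u s Hu [Hs0 Hs1]; apply HK; auto; split; lra.
  - intros V HV u s Hu [Hs0 Hs1] HVs; destruct (Hc V HV u (1 - s)) as [d [Hd HH]]; auto.
    { split; lra. }
    exists d; split; [exact Hd |]; intros u' s' Hu' [Hs'0 Hs'1]; rewrite !Rabs_lt_iff; intros.
    apply HH; auto; rewrite ?Rabs_lt_iff; [split |..]; lra.
Qed.

Lemma family_compose (a b : set E) (g : R -> set E) (phi : R -> R -> R) :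
  pathK T t a b g -> (forall u s, I01 u -> I01 s -> I01 (phi u s)) ->
  (exists K, 0 < K /\ forall u s u' s', I01 u -> I01 s -> I01 u' -> I01 s' ->
     Rabs (phi u' s' - phi u s) <= K * (Rabs (u' - u) + Rabs (s' - s))) ->
  family (fun u s => g (phi u s)).
Proof.
  intros [HK [Hc _]] Hphi [K [HK0 HL]]; split; [auto |].
  intros V HV u s Hu Hs HVs; destruct (Hc V HV (phi u s) (Hphi u s Hu Hs) HVs) as [d [Hd HH]].
  exists (d / (2 * K)); split; [apply Rdiv_lt_0_compat; lra |].
  intros u' s' Hu' Hs' Hud Hsd; apply HH; auto.
  eapply Rle_lt_trans; [apply HL; auto |].
  apply Rlt_le_trans with (K * (d / (2 * K) + d / (2 * K))).
  - apply Rmult_lt_compat_l; lra.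
  - right; field; lra.
Qed.

(** Convexity of the unit interval: two reparametrizations of one path are joined by the
    straight-line homotopy of their parameters. *)
Lemma family_interpolate (a b : set E) (g : R -> set E) (phi psi : R -> R) :
  pathK T t a b g -> reparam phi -> reparam psi ->
  family (fun u s => g ((1 - u) * phi s + u * psi s)).
Proof.
  intros Hg [Hphi [K [HK HLphi]]] [Hpsi [L [HL HLpsi]]].
  apply (family_compose a b g (fun u s => (1 - u) * phi s + u * psi s)); [exact Hg | |].
  - intros u s [Hu0 Hu1] Hs; destruct (Hphi s Hs), (Hpsi s Hs); split; nra.
  - exists (1 + K + L); split; [lra |]; intros u s u' s' [Hu0 Hu1] Hs [Hu'0 Hu'1] Hs'.
    (* The sum separates the variation in [s] from that in [u]; the latter is at most
       [Rabs (u' - u)] because [phi] and [psi] take values in the unit interval. *)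
    replace ((1 - u') * phi s' + u' * psi s' - ((1 - u) * phi s + u * psi s))
      with (((1 - u') * (phi s' - phi s) + u' * (psi s' - psi s)) +
            (u' - u) * (psi s - phi s)) by ring.
    eapply Rle_trans; [apply Rabs_triang |].
    eapply Rle_trans; [apply Rplus_le_compat_r, Rabs_triang |].
    rewrite !Rabs_mult, (Rabs_right (1 - u')), (Rabs_right u') by lra.
    pose proof (HLphi s' s Hs' Hs); pose proof (HLpsi s' s Hs' Hs).
    pose proof (Rabs_pos (phi s' - phi s)); pose proof (Rabs_pos (psi s' - psi s)).
    pose proof (Rabs_pos (u' - u)); pose proof (Rabs_pos (s' - s)).
    assert (Rabs (psi s - phi s) <= 1).
    { destruct (Hphi s Hs), (Hpsi s Hs); apply Rabs_le; lra. }
    assert ((1 - u') * Rabs (phi s' - phi s) <= K * Rabs (s' - s)) by nra.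
    assert (u' * Rabs (psi s' - psi s) <= L * Rabs (s' - s)) by nra.
    assert (Rabs (u' - u) * Rabs (psi s - phi s) <= Rabs (u' - u)) by nra.
    nra.
Qed.

Lemma reparam_affine (p q : R) :
  I01 q -> I01 (p + q) -> reparam (fun s => p * s + q).
Proof.
  intros [Hq0 Hq1] [Hp0 Hp1]; split.
  - intros s [Hs0 Hs1]; split; nra.
  - exists (1 + Rabs p); pose proof (Rabs_pos p); split; [lra |]; intros r s _ _.
    replace (p * r + q - (p * s + q)) with (p * (r - s)) by ring.
    rewrite Rabs_mult; pose proof (Rabs_pos (r - s)); nra.
Qed.

Lemma path_reparam (a b : set E) (g : R -> set E) (phi : R -> R) :
  pathK T t a b g -> reparam phi -> pathK T t (g (phi 0)) (g (phi 1)) (fun s => g (phi s)).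
Proof.
  intros Hg Hphi.
  apply (pathK_ext _ _ (fun s => g ((1 - 0) * phi s + 0 * phi s))).
  { intros s _; f_equal; ring. }
  apply (family_path (fun u s => g ((1 - u) * phi s + u * phi s))); auto;
    [eapply family_interpolate; eauto | f_equal; ring ..].
Qed.

Lemma path_concat (a b c : set E) (g h : R -> set E) :
  pathK T t a b g -> pathK T t b c h -> pathK T t a c (concat g h).
Proof.
  intros Hg Hh; assert (Hgh : g 1 = h 0).
  { destruct Hg as [_ [_ [_ ->]]], Hh as [_ [_ [-> _]]]; reflexivity. }
  apply (family_path (fun _ => concat g h) a c 0); auto.
  - apply (family_concat (fun _ => g) (fun _ => h)); auto; eapply path_family; eauto.
  - rewrite concat_0; apply Hg.
  - rewrite concat_1; apply Hh.
Qed.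

Lemma path_rev (a b : set E) (g : R -> set E) :
  pathK T t a b g -> pathK T t b a (rev_path g).
Proof.
  intro Hg; apply (family_path (fun _ => rev_path g) b a 0); auto.
  - apply (family_rev (fun _ => g)); eapply path_family; eauto.
  - rewrite rev_path_0; apply Hg.
  - rewrite rev_path_1; apply Hg.
Qed.

Lemma path_const (C : set E) : isK T t C -> pathK T t C C (const_path C).
Proof.
  intro HC; repeat split; auto; intros V HV s Hs HVs; exists 1; split; auto; lra.
Qed.

End Paths.

(** * Holonomy of local systems *)

Section GroupLemmas.
Variable G : Group.
Local Infix "*" := (gmul G).
Local Notation "1" := (gone G).
Local Notation inv := (ginv G).

Lemma gmulKV (a b : G) : a * (inv a * b) = b.
Proof. rewrite gassoc, ginv_r, gone_l; reflexivity. Qed.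

Lemma gmulVK (a b : G) : inv a * (a * b) = b.
Proof. rewrite gassoc, ginv_l, gone_l; reflexivity. Qed.

Lemma gmul_cancel_l (a b c : G) : a * b = a * c -> b = c.
Proof. intro H; rewrite <- (gmulVK a b), H, gmulVK; reflexivity. Qed.

Lemma ginv_unique (a b : G) : a * b = 1 -> inv a = b.
Proof. intro H; apply (gmul_cancel_l a); rewrite H; apply ginv_r. Qed.

Lemma ginv_one : inv 1 = 1.
Proof. apply ginv_unique, gone_l. Qed.

Lemma gmul_idem (a : G) : a * a = a -> a = 1.
Proof. intro H; apply (gmul_cancel_l a); rewrite gone_r; exact H. Qed.
End GroupLemmas.

(* A flat principal G-bundle over K_t, up to the choice of representatives in the total space: two points
   of [ls_pt] over the same point of K_t with the same chart values stand for the same point. *)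
Record local_system (G : Group) (T : tiling_t) (t : R) := {
  ls_pt : Type;
  ls_idx : Type;
  ls_pr : ls_pt -> set E;
  ls_cov : ls_idx -> set (set E);
  ls_tv : ls_idx -> ls_pt -> G;
  ls_isK : forall p, isK T t (ls_pr p);
  ls_open : forall i, openK T t (ls_cov i);
  ls_all : forall C, isK T t C -> exists i, ls_cov i C;
  ls_fib : forall i C g, isK T t C -> ls_cov i C -> exists p, ls_pr p = C /\ ls_tv i p = g;
  ls_trans : forall i j C, isK T t C -> ls_cov i C -> ls_cov j C ->
    exists V c, openK T t V /\ V C /\
      forall p, V (ls_pr p) -> ls_cov i (ls_pr p) -> ls_cov j (ls_pr p) ->
        ls_tv j p = gmul G c (ls_tv i p)
}.

Arguments ls_pt {G T t}. Arguments ls_idx {G T t}. Arguments ls_pr {G T t}.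
Arguments ls_cov {G T t}. Arguments ls_tv {G T t}.

Lemma choice_fun (A B : Type) (P : A -> B -> Prop) :
  (forall a, exists b, P a b) -> exists f : A -> B, forall a, P a (f a).
Proof.
  intro H; exists (fun a => proj1_sig (constructive_indefinite_description _ (H a))).
  intro a; apply proj2_sig.
Qed.

Section Holonomy.
Variables (G : Group) (T : tiling_t) (t : R) (L : local_system G T t).
Local Infix "*" := (gmul G).
Local Notation e := (gone G).
Local Notation pr := (ls_pr L).
Local Notation cov := (ls_cov L).
Local Notation tv := (ls_tv L).

(** The relation q = p.g of the covering of K_t, read in charts. With [g = e] it says that [p] and
    [q] stand for the same point of the covering. *)
Definition fib_rel (p q : ls_pt L) (g : G) : Prop :=
  pr p = pr q /\ forall i, cov i (pr p) -> tv i q = tv i p * g.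

(** One chart suffices because transition functions multiply on the left and [g] on the right. *)
Lemma fib_rel_chart (i : ls_idx L) (p q : ls_pt L) (g : G) :
  pr p = pr q -> cov i (pr p) -> tv i q = tv i p * g -> fib_rel p q g.
Proof.
  intros Hpq Hi Hg; split; [exact Hpq |]; intros j Hj.
  destruct (ls_trans _ _ _ L i j (pr p) (ls_isK _ _ _ L p) Hi Hj) as [V [c [_ [HV H]]]].
  rewrite (H q), (H p), Hg by (rewrite <- ?Hpq; assumption); apply gassoc.
Qed.

Lemma fib_rel_ex (p q : ls_pt L) : pr p = pr q -> exists g, fib_rel p q g.
Proof.
  intro Hpq; destruct (ls_all _ _ _ L (pr p) (ls_isK _ _ _ L p)) as [i Hi].
  exists (ginv G (tv i p) * tv i q); apply (fib_rel_chart i); auto.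
  rewrite gmulKV; reflexivity.
Qed.

Lemma fib_rel_refl (p : ls_pt L) : fib_rel p p e.
Proof. split; [reflexivity |]; intros; rewrite gone_r; reflexivity. Qed.

Lemma fib_rel_trans (p q r : ls_pt L) (g h : G) :
  fib_rel p q g -> fib_rel q r h -> fib_rel p r (g * h).
Proof.
  intros [H Hg] [H' Hh]; split; [congruence |]; intros i Hi.
  rewrite Hh, Hg, gassoc by congruence; reflexivity.
Qed.

Lemma fib_rel_sym (p q : ls_pt L) (g : G) : fib_rel p q g -> fib_rel q p (ginv G g).
Proof.
  intros [H Hg]; split; [congruence |]; intros i Hi.
  rewrite Hg, <- gassoc, ginv_r, gone_r by congruence; reflexivity.
Qed.

Lemma fib_rel_sym1 (p q : ls_pt L) : fib_rel p q e -> fib_rel q p e.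
Proof. intro H; rewrite <- (ginv_one G); apply fib_rel_sym, H. Qed.

Lemma fib_rel_trans1 (p q r : ls_pt L) (g : G) :
  fib_rel p q e -> fib_rel q r g -> fib_rel p r g.
Proof. intros H H'; rewrite <- (gone_l G g); eapply fib_rel_trans; eauto. Qed.

Lemma fib_rel_trans2 (p q r : ls_pt L) (g : G) :
  fib_rel p q g -> fib_rel q r e -> fib_rel p r g.
Proof. intros H H'; rewrite <- (gone_r G g); eapply fib_rel_trans; eauto. Qed.

Lemma fib_rel_uniq (p q : ls_pt L) (g h : G) : fib_rel p q g -> fib_rel p q h -> g = h.
Proof.
  intros [_ Hg] [_ Hh]; destruct (ls_all _ _ _ L (pr p) (ls_isK _ _ _ L p)) as [i Hi].
  apply (gmul_cancel_l G (tv i p)); rewrite <- Hg, Hh by exact Hi; reflexivity.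
Qed.

Lemma fib_rel_act (p : ls_pt L) (g : G) : exists q, fib_rel p q g.
Proof.
  destruct (ls_all _ _ _ L (pr p) (ls_isK _ _ _ L p)) as [i Hi].
  destruct (ls_fib _ _ _ L i (pr p) (tv i p * g) (ls_isK _ _ _ L p) Hi) as [q [Hq Hg]].
  exists q; apply (fib_rel_chart i); auto.
Qed.

(** Continuity in charts: since [G] is discrete, a lift has locally constant chart values. The bound
    [c] serves the continuation argument of [lift_exists]. *)
Definition lift_upto (c : R) (g : R -> set E) (l : R -> ls_pt L) : Prop :=
  forall s, 0 <= s <= c -> pr (l s) = g s /\
    forall i, cov i (g s) -> exists d, 0 < d /\
      forall s', 0 <= s' <= c -> Rabs (s' - s) < d ->
        cov i (g s') /\ tv i (l s') = tv i (l s).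

Definition is_lift (g : R -> set E) (l : R -> ls_pt L) : Prop := lift_upto 1 g l.

Lemma lift_restrict (c c' : R) (g : R -> set E) (l : R -> ls_pt L) :
  c <= c' -> lift_upto c' g l -> lift_upto c g l.
Proof.
  intros Hc H s Hs; destruct (H s) as [Hp Hl]; [lra |]; split; [exact Hp |].
  intros i Hi; destruct (Hl i Hi) as [d [Hd HH]]; exists d; split; [exact Hd |].
  intros s' Hs'; apply HH; lra.
Qed.

(** Transition functions are locally constant, so a section that is constant in chart [i] is locally
    constant in every other chart. *)
Lemma chart_section_const (a b : set E) (g : R -> set E) (i : ls_idx L) (c c' : R)
  (q : R -> ls_pt L) (v : G) :
  pathK T t a b g -> 0 <= c -> c' <= 1 ->
  (forall s, c <= s <= c' -> cov i (g s) /\ pr (q s) = g s /\ tv i (q s) = v) ->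
  forall s, c <= s <= c' -> forall j, cov j (g s) -> exists d, 0 < d /\
    forall s', c <= s' <= c' -> Rabs (s' - s) < d ->
      cov j (g s') /\ tv j (q s') = tv j (q s).
Proof.
  intros [HK [Hg _]] Hc Hc' Hq s Hs j Hj.
  assert (Hs1 : I01 s) by (split; lra).
  destruct (Hq s Hs) as [Hi [Hp Hv]].
  destruct (ls_trans _ _ _ L i j (g s) (HK s Hs1) Hi Hj) as [V [k [HV [HVs H]]]].
  pose proof (openK_inter T t V (cov j) HV (ls_open _ _ _ L j)) as HVj.
  destruct (Hg _ HVj s Hs1 (conj HVs Hj)) as [d [Hd HH]].
  exists d; split; [exact Hd |]; intros s' Hs' Hsd.
  destruct (HH s') as [HVs' Hj']; [split; lra | exact Hsd |].
  destruct (Hq s' Hs') as [Hi' [Hp' Hv']].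
  split; [exact Hj' |]; rewrite !H by congruence; congruence.
Qed.

Lemma lift_extend (a b : set E) (g : R -> set E) (i : ls_idx L) (c c' : R)
  (l : R -> ls_pt L) :
  pathK T t a b g -> 0 <= c -> c <= c' -> c' <= 1 ->
  (forall s, c <= s <= c' -> cov i (g s)) -> lift_upto c g l ->
  exists l', lift_upto c' g l' /\ l' 0 = l 0.
Proof.
  intros Hg Hc Hcc Hc' Hi Hl.
  (* Beyond [c] the lift follows the sheet of chart [i] through [l c]. *)
  destruct (choice_fun R (ls_pt L) (fun s q => c <= s <= c' ->
    cov i (g s) /\ pr q = g s /\ tv i q = tv i (l c))) as [q Hq].
  { intro s; destruct (classic (c <= s <= c')) as [Hs | Hs]; [| exists (l 0); tauto].
    destruct (ls_fib _ _ _ L i (g s) (tv i (l c))) as [p Hp]; auto.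
    - destruct Hg as [HK _]; apply HK; split; lra.
    - exists p; auto. }
  pose proof (chart_section_const a b g i c c' q _ Hg Hc Hc' Hq) as Hqc.
  (* At [c] the two pieces may use different representatives; their chart values agree, which is all
     that continuity of the glued lift requires. *)
  assert (Hqlc : fib_rel (l c) (q c) e).
  { destruct (Hq c) as [H1 [H2 H3]]; [lra |]; destruct (Hl c) as [H4 _]; [lra |].
    apply (fib_rel_chart i); [congruence | congruence |]; rewrite gone_r; exact H3. }
  set (l' := fun s => if Rle_dec s c then l s else q s).
  assert (Hl'l : forall s, s <= c -> l' s = l s).
  { intros s Hs; unfold l'; destruct Rle_dec; [reflexivity | lra]. }
  assert (Hl'q : forall s, c < s -> l' s = q s).
  { intros s Hs; unfold l'; destruct Rle_dec; [lra | reflexivity]. }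
  exists l'; split; [| apply Hl'l; exact Hc].
  intros s Hs; destruct (Rtotal_order s c) as [Hsc | [Hsc | Hsc]].
  - rewrite Hl'l by lra; destruct (Hl s) as [Hp H]; [lra |].
    split; [exact Hp |]; intros j Hj; destruct (H j Hj) as [d [Hd HH]].
    exists (Rmin d (c - s)); split; [apply Rmin_glb_lt; lra |]; intros s' Hs' Hsd.
    pose proof (Rmin_l d (c - s)); pose proof (Rmin_r d (c - s)).
    apply Rabs_lt_iff in Hsd as Hsd'; rewrite Hl'l by lra; apply HH; lra.
  - subst s; rewrite Hl'l by lra; destruct (Hl c) as [Hp H]; [lra |].
    split; [exact Hp |]; intros j Hj; destruct (H j Hj) as [d [Hd HH]].
    destruct (Hqc c) with (j := j) as [d' [Hd' HH']]; [lra | exact Hj |].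
    exists (Rmin d d'); split; [apply Rmin_glb_lt; lra |]; intros s' Hs' Hsd.
    pose proof (Rmin_l d d'); pose proof (Rmin_r d d').
    destruct (Rle_dec s' c).
    + rewrite Hl'l by lra; apply HH; lra.
    + rewrite Hl'q by lra; destruct (HH' s') as [H2 H3]; [lra.. |]; split; [exact H2 |].
      rewrite H3; destruct Hqlc as [_ Hqlc]; rewrite Hqlc by congruence; apply gone_r.
  - rewrite Hl'q by lra; destruct (Hq s) as [_ [Hp _]]; [lra |].
    split; [exact Hp |]; intros j Hj; destruct (Hqc s) with (j := j) as [d [Hd HH]]; [lra | exact Hj |].
    exists (Rmin d (s - c)); split; [apply Rmin_glb_lt; lra |]; intros s' Hs' Hsd.
    pose proof (Rmin_l d (s - c)); pose proof (Rmin_r d (s - c)).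
    apply Rabs_lt_iff in Hsd as Hsd'; rewrite Hl'q by lra; apply HH; lra.
Qed.

(** Inside one chart a lift can be continued or restricted, so the existence of a lift up to [c] is
    a locally constant property of [c]. *)
Lemma lift_exists (a b : set E) (g : R -> set E) (p : ls_pt L) :
  pathK T t a b g -> pr p = a -> exists l, is_lift g l /\ l 0 = p.
Proof.
  intros Hg Hp.
  apply (I01_connected (fun c => exists l, lift_upto c g l /\ l 0 = p)) with 0; auto.
  - intros c Hc; destruct Hg as [HK [Hc' Hends]] eqn:Heq; clear Heq.
    destruct (ls_all _ _ _ L (g c) (HK c Hc)) as [i Hi].
    destruct (Hc' _ (ls_open _ _ _ L i) c Hc Hi) as [d [Hd HH]].
    assert (Hext : forall r r', I01 r -> I01 r' -> Rabs (r - c) < d -> Rabs (r' - c) < d ->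
      r <= r' -> (exists l, lift_upto r g l /\ l 0 = p) -> exists l, lift_upto r' g l /\ l 0 = p).
    { intros r r' [Hr0 Hr1] [Hr'0 Hr'1] Hrd Hr'd Hle [l [Hl Hl0]].
      apply Rabs_lt_iff in Hrd, Hr'd.
      destruct (lift_extend a b g i r r' l) as [l' [Hl' Hl'0]]; auto.
      - intros s Hs; apply HH; [split | apply Rabs_lt_iff]; lra.
      - exists l'; split; [exact Hl' | congruence]. }
    assert (Hres : forall r r', r <= r' ->
      (exists l, lift_upto r' g l /\ l 0 = p) -> exists l, lift_upto r g l /\ l 0 = p).
    { intros r r' Hle [l [Hl Hl0]]; exists l; split; [eapply lift_restrict; eauto | exact Hl0]. }
    assert (Hcd : Rabs (c - c) < d) by (rewrite Rminus_diag, Rabs_R0; exact Hd).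
    exists d; split; [exact Hd |]; intros c' Hc'1 Hc'd.
    destruct (Rle_dec c c') as [Hle | Hle]; split; eauto.
    + apply Hres; lra.
    + apply Hext; auto; lra.
  - exists (fun _ => p); split; [| reflexivity]; intros s Hs.
    assert (s = 0) by lra; subst s; destruct Hg as [_ [_ [Hg0 _]]].
    split; [congruence |]; intros i Hi; exists 1; split; [lra |].
    intros s' Hs' _; replace s' with 0 by lra; auto.
Qed.

Lemma lift_pr (g : R -> set E) (l : R -> ls_pt L) (s : R) :
  is_lift g l -> I01 s -> pr (l s) = g s.
Proof. intros H Hs; apply (H s Hs). Qed.

Lemma lift_ext (g h : R -> set E) (l : R -> ls_pt L) :
  (forall s, I01 s -> g s = h s) -> is_lift g l -> is_lift h l.
Proof.
  intros He H s Hs; destruct (H s Hs) as [Hp Hl]; rewrite <- He by exact Hs.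
  split; [exact Hp |]; intros i Hi; destruct (Hl i Hi) as [d [Hd HH]].
  exists d; split; [exact Hd |]; intros s' Hs'; rewrite <- He by exact Hs'; auto.
Qed.

Lemma lift_reparam (g : R -> set E) (l : R -> ls_pt L) (phi : R -> R) :
  reparam phi -> is_lift g l -> is_lift (fun s => g (phi s)) (fun s => l (phi s)).
Proof.
  intros [Hphi [K [HK HL]]] H s Hs; destruct (H (phi s) (Hphi s Hs)) as [Hp Hl].
  split; [exact Hp |]; intros i Hi; destruct (Hl i Hi) as [d [Hd HH]].
  exists (d / K)%R; split; [apply Rdiv_lt_0_compat; lra |]; intros s' Hs' Hsd.
  apply HH; [apply Hphi, Hs' |]; eapply Rle_lt_trans; [apply HL; assumption |].
  replace d with (K * (d / K))%R by (field; lra); apply Rmult_lt_compat_l; lra.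
Qed.

Lemma lift_half_l (g h : R -> set E) (l : R -> ls_pt L) :
  is_lift (concat g h) l -> is_lift g (fun s => l (/ 2 * s)%R).
Proof.
  intro H; apply (lift_ext (fun s => concat g h (/ 2 * s + 0))).
  { intros s [Hs0 Hs1]; rewrite concat_l by lra; f_equal; lra. }
  replace (fun s => l (/ 2 * s)%R) with (fun s => l (/ 2 * s + 0)%R)
    by (apply functional_extensionality; intro; f_equal; ring).
  apply (lift_reparam _ l (fun s => / 2 * s + 0)%R); [apply reparam_affine; split; lra | exact H].
Qed.

Lemma lift_half_r (g h : R -> set E) (l : R -> ls_pt L) :
  g 1 = h 0 -> is_lift (concat g h) l -> is_lift h (fun s => l (/ 2 * s + / 2)%R).
Proof.
  intros Hgh H; apply (lift_ext (fun s => concat g h (/ 2 * s + / 2))).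
  { intros s [Hs0 Hs1]; rewrite concat_r by (auto; lra); f_equal; lra. }
  apply (lift_reparam _ l (fun s => / 2 * s + / 2)%R); [apply reparam_affine; split; lra | exact H].
Qed.

Lemma lift_rev (g : R -> set E) (l : R -> ls_pt L) :
  is_lift g l -> is_lift (rev_path g) (fun s => l (1 - s)).
Proof.
  intro H; replace (fun s => l (1 - s)) with (fun s => l (-1 * s + 1)%R)
    by (apply functional_extensionality; intro; f_equal; ring).
  replace (rev_path g) with (fun s => g (-1 * s + 1)%R)
    by (apply functional_extensionality; intro; unfold rev_path; f_equal; ring).
  apply (lift_reparam g l (fun s => -1 * s + 1)%R); [apply reparam_affine; split; lra | exact H].
Qed.

(** Uniqueness of lifts, in equivariant form: both lifts are locally constant in a chart, hence so
    is their relative position. The anchor [r] is free because comparisons start at either end. *)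
Lemma lift_fib_rel (g : R -> set E) (l m : R -> ls_pt L) (r : R) (h : G) :
  is_lift g l -> is_lift g m -> I01 r -> fib_rel (l r) (m r) h ->
  forall s, I01 s -> fib_rel (l s) (m s) h.
Proof.
  intros Hl Hm Hr Hrel s Hs.
  refine (I01_connected (fun s => fib_rel (l s) (m s) h) _ r s Hr Hs Hrel); clear s Hs.
  intros s Hs; destruct (Hl s Hs) as [Hlp Hlc], (Hm s Hs) as [Hmp Hmc].
  destruct (ls_all _ _ _ L (pr (l s)) (ls_isK _ _ _ L _)) as [i Hi]; rewrite Hlp in Hi.
  destruct (Hlc i Hi) as [d [Hd HH]], (Hmc i Hi) as [d' [Hd' HH']].
  exists (Rmin d d'); split; [apply Rmin_glb_lt; lra |]; intros s' Hs' Hsd.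
  pose proof (Rmin_l d d'); pose proof (Rmin_r d d').
  destruct (HH s' Hs') as [Hc' Hl']; [lra |]; destruct (HH' s' Hs') as [_ Hm']; [lra |].
  pose proof (lift_pr _ _ _ Hl Hs'); pose proof (lift_pr _ _ _ Hm Hs').
  split; intros [_ Hrel']; apply (fib_rel_chart i); try congruence.
  - rewrite Hl', Hm'; apply Hrel'; congruence.
  - rewrite <- Hl', <- Hm'; apply Hrel'; congruence.
Qed.

Lemma lift_in_chart (g : R -> set E) (l : R -> ls_pt L) (i : ls_idx L) :
  is_lift g l -> (forall s, I01 s -> cov i (g s)) ->
  forall r s, I01 r -> I01 s -> tv i (l s) = tv i (l r).
Proof.
  intros Hl Hi r s Hr Hs.
  refine (I01_connected (fun s => tv i (l s) = tv i (l r)) _ r s Hr Hs eq_refl).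
  intros c Hc; destruct (Hl c Hc) as [_ H]; destruct (H i (Hi c Hc)) as [d [Hd HH]].
  exists d; split; [exact Hd |]; intros s' Hs' Hsd; destruct (HH s' Hs' Hsd) as [_ ->]; tauto.
Qed.

Lemma lift_in_chart_near (g : R -> set E) (l : R -> ls_pt L) (i : ls_idx L) (s d : R) :
  is_lift g l -> I01 s -> (forall s', I01 s' -> Rabs (s' - s) < d -> cov i (g s')) ->
  forall s', I01 s' -> Rabs (s' - s) < d -> tv i (l s') = tv i (l s).
Proof.
  intros Hl Hs Hi s' Hs' Hsd; destruct Hs as [Hs0 Hs1], Hs' as [Hs'0 Hs'1].
  apply Rabs_lt_iff in Hsd.
  assert (Hphi : reparam (fun r => (s' - s) * r + s)%R) by (apply reparam_affine; split; lra).
  assert (H := lift_in_chart _ _ i (lift_reparam g l _ Hphi Hl)).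
  replace s' with ((s' - s) * 1 + s)%R at 1 by ring.
  replace s with ((s' - s) * 0 + s)%R at 3 by ring.
  apply (H) with (r := 0) (s := 1); auto.
  intros r [Hr0 Hr1]; apply Hi; [apply Hphi; split; lra | apply Rabs_lt_iff; split; nra].
Qed.

(* The inverse of the end point of the lift, so that the right action makes holonomy multiplicative. *)
Definition hol (p0 : ls_pt L) (g : R -> set E) (a : G) : Prop :=
  exists l, is_lift g l /\ fib_rel p0 (l 0) e /\ fib_rel (l 1) p0 a.

Lemma hol_exists (p0 : ls_pt L) (g : R -> set E) :
  loopK T t (pr p0) g -> exists a, hol p0 g a.
Proof.
  intro Hg; destruct (lift_exists _ _ g p0 Hg eq_refl) as [l [Hl Hl0]].
  destruct (fib_rel_ex (l 1) p0) as [a Ha].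
  { rewrite (lift_pr g); auto; apply Hg. }
  exists a, l; repeat split; try apply Hl; try apply Ha; auto; rewrite Hl0;
    [reflexivity | intros; rewrite gone_r; reflexivity].
Qed.

Lemma hol_unique (p0 : ls_pt L) (g : R -> set E) (a b : G) :
  hol p0 g a -> hol p0 g b -> a = b.
Proof.
  intros [l [Hl [Hl0 Hl1]]] [m [Hm [Hm0 Hm1]]].
  apply (fib_rel_uniq (l 1) p0); [exact Hl1 |].
  apply (fib_rel_trans1 _ (m 1)); [| exact Hm1].
  apply (lift_fib_rel g l m 0); auto.
  apply (fib_rel_trans1 _ p0); [apply fib_rel_sym1 |]; assumption.
Qed.

(** The lift of [g] ends at [p0] translated by the inverse of [a]. The lift of [h] continued from
    there is its lift from [p0] translated by the same element, so it ends at [p0] translated by the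
    inverse of [a * b]. *)
Lemma hol_concat (p0 : ls_pt L) (g h : R -> set E) (a b : G) :
  loopK T t (pr p0) g -> loopK T t (pr p0) h ->
  hol p0 g a -> hol p0 h b -> hol p0 (concat g h) (a * b).
Proof.
  intros Hg Hh [m [Hm [Hm0 Hm1]]] [n [Hn [Hn0 Hn1]]].
  destruct (lift_exists _ _ (concat g h) p0 (path_concat _ _ _ _ _ _ _ Hg Hh) eq_refl)
    as [l [Hl Hl0]].
  assert (Hgh : g 1 = h 0) by (destruct Hg as [_ [_ [_ ->]]], Hh as [_ [_ [-> _]]]; reflexivity).
  pose proof (lift_half_l _ _ _ Hl) as HL; pose proof (lift_half_r _ _ _ Hgh Hl) as HR.
  exists l; split; [exact Hl |]; split; [rewrite Hl0; apply fib_rel_refl |].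
  assert (H1 : fib_rel (l (/ 2)) p0 a).
  { apply (fib_rel_trans1 _ (m 1)); [| exact Hm1].
    replace (/ 2) with (/ 2 * 1)%R by ring.
    apply (lift_fib_rel g (fun s => l (/ 2 * s)%R) m 0); auto.
    rewrite Rmult_0_r, Hl0; exact Hm0. }
  apply (fib_rel_trans _ (n 1)); [| exact Hn1].
  replace 1 with (/ 2 * 1 + / 2)%R at 1 by field.
  apply (lift_fib_rel h (fun s => l (/ 2 * s + / 2)%R) n 0); auto.
  rewrite Rmult_0_r, Rplus_0_l; apply (fib_rel_trans2 _ p0); assumption.
Qed.

(* The lifts of the paths [H u] from [p0] vary continuously with [u]: this propagates along [s] from [s = 0],
   because lifts are constant in each chart. So the end point is constant in [u]. *)
Lemma hol_homotopy (p0 : ls_pt L) (g0 g1 : R -> set E) (a : G) :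
  homotopic T t (pr p0) g0 g1 -> hol p0 g0 a -> hol p0 g1 a.
Proof.
  intros [H [HK [Hc [Hends Hb]]]] Hol.
  assert (Hfam : family T t H) by (split; assumption).
  assert (Hpath : forall u, I01 u -> loopK T t (pr p0) (H u)).
  { intros u Hu; apply family_path; auto; apply Hb, Hu. }
  destruct (choice_fun R (R -> ls_pt L) (fun u l => I01 u -> is_lift (H u) l /\ l 0 = p0)) as [P HP].
  { intro u; destruct (classic (I01 u)) as [Hu | Hu]; [| exists (fun _ => p0); tauto].
    destruct (lift_exists _ _ (H u) p0 (Hpath u Hu) eq_refl) as [l Hl]; exists l; auto. }
  assert (Hpr : forall u s, I01 u -> I01 s -> pr (P u s) = H u s).
  { intros u s Hu Hs; apply lift_pr; auto; apply HP, Hu. }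
  (* The lifts [P u] are chosen independently for each [u]; [near u i s] asserts that at time [s]
     they nevertheless have one value in chart [i] for parameters close to [u]. *)
  set (near := fun u i s => exists d, 0 < d /\ forall u', I01 u' -> Rabs (u' - u) < d ->
    cov i (H u' s) /\ tv i (P u' s) = tv i (P u s)).
  assert (Hchart : forall u i j s, I01 u -> I01 s -> cov i (H u s) -> cov j (H u s) ->
    near u i s -> near u j s).
  { intros u i j s Hu Hs Hi Hj [d [Hd HH]].
    destruct (ls_trans _ _ _ L i j (H u s) (HK u s Hu Hs) Hi Hj) as [V [k [HV [HVs HH']]]].
    destruct (Hc _ (openK_inter T t V (cov j) HV (ls_open _ _ _ L j)) u s Hu Hs (conj HVs Hj))
      as [d' [Hd' HH'']].
    exists (Rmin d d'); split; [apply Rmin_glb_lt; lra |]; intros u' Hu' Hud.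
    pose proof (Rmin_l d d'); pose proof (Rmin_r d d').
    destruct (HH u' Hu') as [Hi' Htv]; [lra |].
    destruct (HH'' u' s Hu' Hs) as [HV' Hj'];
      [lra | rewrite Rminus_diag, Rabs_R0; exact Hd' |].
    split; [exact Hj' |]; rewrite !HH' by (rewrite Hpr; auto); congruence. }
  assert (Hcont : forall u s, I01 u -> I01 s -> forall i, cov i (H u s) -> near u i s).
  { intros u s Hu Hs.
    refine (I01_connected (fun s => forall i, cov i (H u s) -> near u i s) _ 0 s I01_0 Hs _).
    - clear s Hs; intros s Hs; destruct (ls_all _ _ _ L (H u s) (HK u s Hu Hs)) as [i Hi].
      destruct (Hc _ (ls_open _ _ _ L i) u s Hu Hs Hi) as [d [Hd HH]].
      (* On a product neighbourhood of [(u, s)] that [H] sends into chart [i], no lift changes its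
         chart value with time. So [near u i] at one time of the neighbourhood gives it at every
         other. *)
      assert (Hmove : forall s' u', I01 s' -> I01 u' -> Rabs (s' - s) < d -> Rabs (u' - u) < d ->
        cov i (H u' s') /\ tv i (P u' s') = tv i (P u' s)).
      { intros s' u' Hs' Hu' Hsd Hud; split; [apply HH; auto |].
        apply (lift_in_chart_near (H u') _ i s d); auto; apply HP, Hu'. }
      assert (Huu : Rabs (u - u) < d) by (rewrite Rminus_diag, Rabs_R0; exact Hd).
      assert (Hss : Rabs (s - s) < d) by (rewrite Rminus_diag, Rabs_R0; exact Hd).
      assert (Hnear : forall r r', I01 r -> I01 r' -> Rabs (r - s) < d -> Rabs (r' - s) < d ->
        near u i r -> near u i r').
      { intros r r' Hr Hr' Hrd Hr'd [d' [Hd' HH']].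
        exists (Rmin d d'); split; [apply Rmin_glb_lt; lra |]; intros u' Hu' Hud.
        pose proof (Rmin_l d d'); pose proof (Rmin_r d d').
        destruct (HH' u' Hu') as [_ Htv]; [lra |].
        destruct (Hmove r u' Hr Hu') as [_ E1]; [lra.. |].
        destruct (Hmove r' u' Hr' Hu') as [Hci E2]; [lra.. |].
        destruct (Hmove r u Hr Hu) as [_ E3]; [lra.. |].
        destruct (Hmove r' u Hr' Hu) as [_ E4]; [lra.. |].
        split; [exact Hci |]; congruence. }
      exists d; split; [exact Hd |]; intros s' Hs' Hsd.
      destruct (Hmove s' u Hs' Hu Hsd Huu) as [Hi' _].
      split; intros Hn j Hj.
      + apply (Hchart u i j); auto; apply (Hnear s s'); auto.
      + apply (Hchart u i j); auto; apply (Hnear s' s); auto.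
    - intros i Hi; exists 1; split; [lra |]; intros u' Hu' _.
      destruct (HP u Hu) as [_ ->], (HP u' Hu') as [_ ->]; split; [| reflexivity].
      destruct (Hb u Hu) as [E1 _], (Hb u' Hu') as [-> _]; congruence. }
  (* All end points lie over the base point, so equal chart values make them the same point of the
     covering. *)
  assert (Hend : fib_rel (P 0 1) (P 1 1) e).
  { refine (I01_connected (fun u => fib_rel (P 0 1) (P u 1) e) _ 0 1 I01_0 I01_1 (fib_rel_refl _)).
    intros u Hu; destruct (ls_all _ _ _ L (H u 1) (HK u 1 Hu I01_1)) as [i Hi].
    destruct (Hcont u 1 Hu I01_1 i Hi) as [d [Hd HH]]; exists d; split; [exact Hd |].
    intros u' Hu' Hud; destruct (HH u' Hu' Hud) as [_ Htv].
    assert (Hrel : fib_rel (P u 1) (P u' 1) e).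
    { apply (fib_rel_chart i); rewrite ?Hpr, ?gone_r by auto; auto.
      destruct (Hb u Hu) as [_ ->], (Hb u' Hu') as [_ ->]; reflexivity. }
    split; intro Hr; eapply fib_rel_trans2; eauto using fib_rel_sym1. }
  destruct (HP 0 I01_0) as [HP0 HP00], (HP 1 I01_1) as [HP1 HP10].
  exists (P 1); split; [| split].
  - apply (lift_ext (H 1)); [| exact HP1]; intros s Hs; apply Hends, Hs.
  - rewrite HP10; apply fib_rel_refl.
  - destruct Hol as [m [Hm [Hm0 Hm1]]].
    apply (fib_rel_trans1 _ (P 0 1)); [apply fib_rel_sym1, Hend |].
    apply (fib_rel_trans1 _ (m 1)); [| exact Hm1].
    apply (lift_fib_rel g0 (P 0) m 0); auto; [| rewrite HP00; exact Hm0].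
    apply (lift_ext (H 0)); [| exact HP0]; intros s Hs; apply Hends, Hs.
Qed.

Lemma hol_isHom (p0 : ls_pt L) :
  exists rho, isHom G T t (pr p0) rho /\
    forall g, loopK T t (pr p0) g -> hol p0 g (rho g).
Proof.
  destruct (choice_fun (R -> set E) G (fun g a => loopK T t (pr p0) g -> hol p0 g a)) as [rho Hrho].
  { intro g; destruct (classic (loopK T t (pr p0) g)) as [Hg | Hg]; [| exists e; tauto].
    destruct (hol_exists p0 g Hg) as [a Ha]; exists a; auto. }
  exists rho; split; [split |]; auto; intros g0 g1 H0 H1.
  - intro Hh; apply (hol_unique p0 g1); auto; apply (hol_homotopy p0 g0); auto.
  - apply (hol_unique p0 (concat g0 g1)); [| apply hol_concat; auto].
    apply Hrho; eapply path_concat; eauto.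
Qed.

End Holonomy.

Arguments fib_rel {G T t L}. Arguments is_lift {G T t}. Arguments hol {G T t}.

(** * Comparison of local systems *)

Section Transport.
Variables (G : Group) (T : tiling_t) (t : R) (L1 L2 : local_system G T t).
Variables (p1 : ls_pt L1) (p2 : ls_pt L2).
Hypothesis Hbase : ls_pr L1 p1 = ls_pr L2 p2.
Local Infix "*" := (gmul G).
Local Notation e := (gone G).

(* The start points [p1 h] and [p2 h] are free up to [h] so that the relation is G-equivariant. *)
Definition transported (p : ls_pt L1) (q : ls_pt L2) : Prop :=
  exists g l1 l2 h, pathK T t (ls_pr L1 p1) (ls_pr L1 p) g /\
    is_lift L1 g l1 /\ is_lift L2 g l2 /\
    fib_rel p1 (l1 0) h /\ fib_rel p2 (l2 0) h /\
    fib_rel (l1 1) p e /\ fib_rel (l2 1) q e.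

Lemma transported_base : transported p1 p2.
Proof.
  assert (Hc := path_const T t _ (ls_isK _ _ _ L1 p1)).
  destruct (lift_exists _ _ _ L1 _ _ _ p1 Hc eq_refl) as [l1 [Hl1 H1]].
  destruct (lift_exists _ _ _ L2 _ _ _ p2 Hc (eq_sym Hbase)) as [l2 [Hl2 H2]].
  exists (const_path (ls_pr L1 p1)), (fun _ => p1), (fun _ => p2), e.
  repeat (split; [solve [exact Hc | apply fib_rel_refl
    | intros s _; split; [auto |]; intros i Hi; exists 1; split; [lra | auto]] |]).
  apply fib_rel_refl.
Qed.

Lemma transported_pr (p : ls_pt L1) (q : ls_pt L2) :
  transported p q -> ls_pr L1 p = ls_pr L2 q.
Proof.
  intros [g [l1 [l2 [h [_ [H1 [H2 [_ [_ [[E1 _] [E2 _]]]]]]]]]]].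
  rewrite <- E1, <- E2, (lift_pr _ _ _ _ g l1), (lift_pr _ _ _ _ g l2); auto.
Qed.

Lemma transported_exists (p : ls_pt L1) : path_connectedK T t -> exists q, transported p q.
Proof.
  intro Hpc.
  destruct (Hpc (ls_pr L1 p1) (ls_pr L1 p)) as [g Hg]; try apply ls_isK.
  (* Lifting the reversed path from [p] yields a lift that ends at [p]; its other end determines the
     offset [h]. *)
  assert (Hrev := path_rev _ _ _ _ _ Hg).
  destruct (lift_exists _ _ _ L1 _ _ _ p Hrev eq_refl) as [l1r [Hl1r Hl1r0]].
  apply lift_rev in Hl1r.
  assert (Hrr : forall s, I01 s -> rev_path (rev_path g) s = g s).
  { intros s _; unfold rev_path; f_equal; ring. }
  apply (lift_ext _ _ _ _ _ g _ Hrr) in Hl1r.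
  set (l1 := fun s => l1r (1 - s)) in *.
  assert (H10 : ls_pr L1 p1 = ls_pr L1 (l1 0)).
  { rewrite (lift_pr _ _ _ _ g l1); auto; symmetry; apply Hg. }
  destruct (fib_rel_ex _ _ _ L1 _ _ H10) as [h Hh].
  destruct (fib_rel_act _ _ _ L2 p2 h) as [q0 Hq0].
  destruct (lift_exists _ _ _ L2 _ _ g q0 Hg) as [l2 [Hl2 Hl20]].
  { rewrite Hbase; symmetry; apply Hq0. }
  exists (l2 1), g, l1, l2, h; rewrite Hl20.
  assert (l1 1 = p) as -> by (unfold l1; rewrite Rminus_diag; exact Hl1r0).
  repeat (split; [assumption || apply fib_rel_refl |]); apply fib_rel_refl.
Qed.

Lemma lift_translate (L : local_system G T t) (a b : set E) (g : R -> set E)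
  (l : R -> ls_pt L) (k : G) :
  pathK T t a b g -> is_lift L g l ->
  exists m, is_lift L g m /\ forall s, I01 s -> fib_rel (l s) (m s) k.
Proof.
  intros Hg Hl; destruct (fib_rel_act _ _ _ L (l 0) k) as [q Hq].
  destruct (lift_exists _ _ _ L _ _ g q Hg) as [m [Hm Hm0]].
  { destruct Hq as [<- _]; rewrite (lift_pr _ _ _ _ g l); auto; apply Hg. }
  exists m; split; [exact Hm |]; apply (lift_fib_rel _ _ _ _ g l m 0); auto.
  rewrite Hm0; exact Hq.
Qed.

Lemma transported_act (p p' : ls_pt L1) (q q' : ls_pt L2) (k : G) :
  transported p q -> fib_rel p p' k -> fib_rel q q' k -> transported p' q'.
Proof.
  intros [g [l1 [l2 [h [Hg [H1 [H2 [B1 [B2 [E1 E2]]]]]]]]]] Hp Hq.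
  destruct (lift_translate L1 _ _ g l1 k Hg H1) as [m1 [Hm1 R1]].
  destruct (lift_translate L2 _ _ g l2 k Hg H2) as [m2 [Hm2 R2]].
  assert (Hk : ginv G k * (e * k) = e) by (rewrite gone_l; apply ginv_l).
  exists g, m1, m2, (h * k); split; [rewrite <- (proj1 Hp); exact Hg |].
  split; [exact Hm1 |]; split; [exact Hm2 |]; split; [eapply fib_rel_trans; eauto |].
  split; [eapply fib_rel_trans; eauto |]; rewrite <- Hk; split.
  - eapply fib_rel_trans; [apply fib_rel_sym, R1; auto | eapply fib_rel_trans; eauto].
  - eapply fib_rel_trans; [apply fib_rel_sym, R2; auto | eapply fib_rel_trans; eauto].
Qed.

Hypothesis Hhol : forall g a, loopK T t (ls_pr L1 p1) g -> hol L1 p1 g a -> hol L2 p2 g a.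

(* Two paths to the same point differ by a loop at the base point, on which both holonomies agree. *)
Lemma transported_unique (p : ls_pt L1) (q q' : ls_pt L2) :
  transported p q -> transported p q' -> fib_rel q q' e.
Proof.
  intros [g [l1 [l2 [h [Hg [H1 [H2 [B1 [B2 [E1 E2]]]]]]]]]].
  intros [g' [l1' [l2' [h' [Hg' [H1' [H2' [B1' [B2' [E1' E2']]]]]]]]]].
  assert (Hrev := path_rev _ _ _ _ _ Hg').
  assert (Hloop := path_concat _ _ _ _ _ _ _ Hg Hrev : loopK T t (ls_pr L1 p1) _).
  assert (Hglue : g 1 = rev_path g' 0).
  { rewrite rev_path_0; destruct Hg as [_ [_ [_ ->]]], Hg' as [_ [_ [_ ->]]]; reflexivity. }
  assert (Hrr : forall s, I01 s -> rev_path (rev_path g') s = g' s).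
  { intros s _; unfold rev_path; f_equal; ring. }
  assert (Hsecond : forall (L : local_system G T t) l,
    is_lift L (concat g (rev_path g')) l ->
    is_lift L g' (fun s => l (/ 2 * (1 - s) + / 2)%R)).
  { intros L l Hl; apply (lift_ext _ _ _ _ _ _ _ Hrr).
    apply (lift_rev _ _ _ L (rev_path g') (fun s => l (/ 2 * s + / 2)%R)).
    exact (lift_half_r _ _ _ _ _ _ _ Hglue Hl). }
  destruct (hol_exists _ _ _ L1 p1 _ Hloop) as [a Ha].
  destruct (Hhol _ a Hloop Ha) as [m2 [Hm2 [Bm2 Em2]]].
  destruct Ha as [m1 [Hm1 [Bm1 Em1]]].
  assert (Hmid : forall (L : local_system G T t) (p0 : ls_pt L) l m r,
    is_lift L g l -> is_lift L (concat g (rev_path g')) m ->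
    fib_rel p0 (l 0) h -> fib_rel p0 (m 0) e -> fib_rel (l 1) r e ->
    fib_rel (m (/ 2)) r h).
  { intros L p0 l m r Hl Hm Hl0 Hm0 Hl1; apply (fib_rel_trans2 _ _ _ _ _ (l 1)); [| exact Hl1].
    replace (/ 2) with (/ 2 * 1)%R by ring.
    apply (lift_fib_rel _ _ _ _ g (fun s => m (/ 2 * s)%R) l 0); auto;
      [exact (lift_half_l _ _ _ _ _ _ _ Hm) |].
    rewrite Rmult_0_r; eapply fib_rel_trans1; [apply fib_rel_sym1 |]; eauto. }
  assert (M1 := Hmid L1 p1 l1 m1 p H1 Hm1 B1 Bm1 E1).
  assert (M2 := Hmid L2 p2 l2 m2 q H2 Hm2 B2 Bm2 E2).
  assert (Hhalf : (/ 2 * (1 - 1) + / 2 = / 2)%R) by ring.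
  assert (Hone : (/ 2 * (1 - 0) + / 2 = 1)%R) by field.
  assert (N1 : fib_rel (m1 1) (l1' 0) h).
  { rewrite <- Hone at 1.
    apply (lift_fib_rel _ _ _ _ g' (fun s => m1 (/ 2 * (1 - s) + / 2)%R) l1' 1); auto.
    rewrite Hhalf; eapply fib_rel_trans2; [exact M1 | apply fib_rel_sym1, E1']. }
  (* In [L1] the loop ties the two offsets by its holonomy [a]. The same [a] is its holonomy in
     [L2], so the relation carries over to the end points there. *)
  assert (Hh : h = a * h').
  { apply (fib_rel_uniq _ _ _ _ (m1 1) (l1' 0)); [exact N1 |].
    eapply fib_rel_trans; eauto. }
  assert (N2 : fib_rel (m2 (/ 2)) (l2' 1) h).
  { rewrite <- Hhalf.
    apply (lift_fib_rel _ _ _ _ g' (fun s => m2 (/ 2 * (1 - s) + / 2)%R) l2' 0); auto.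
    rewrite Hone, Hh; eapply fib_rel_trans; eauto. }
  rewrite <- (ginv_l G h).
  eapply fib_rel_trans; [apply fib_rel_sym, M2 |]; eapply fib_rel_trans2; eauto.
Qed.

(** A path from [C] that stays in a path-connected [W] inside both charts changes neither chart
    value along lifts. The constant [c] is therefore read off over [C], at a point [p0] normalized
    to chart value [e]. *)
Lemma transported_local (i : ls_idx L1) (k : ls_idx L2) (C : set E) :
  path_connectedK T t -> loc_path_connectedK T t ->
  isK T t C -> ls_cov L1 i C -> ls_cov L2 k C ->
  exists W c, openK T t W /\ W C /\
    forall p q, transported p q -> W (ls_pr L1 p) -> ls_tv L2 k q = c * ls_tv L1 i p.
Proof.
  intros Hpc Hlpc HC Hi Hk.
  destruct (Hlpc C _ HC (openK_inter T t _ _ (ls_open _ _ _ L1 i) (ls_open _ _ _ L2 k))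
    (conj Hi Hk)) as [W [HW [HWC [HWsub HWpath]]]].
  destruct (ls_fib _ _ _ L1 i C e HC Hi) as [p0 [Hp0 Hp0e]].
  destruct (transported_exists p0 Hpc) as [q0 Hq0].
  exists W, (ls_tv L2 k q0); split; [exact HW |]; split; [exact HWC |].
  intros p q Hpq HWp.
  destruct (HWpath C (ls_pr L1 p) HC (ls_isK _ _ _ L1 p) HWC HWp) as [eta [Heta HWeta]].
  destruct Hq0 as [g [l1 [l2 [h [Hg [H1 [H2 [B1 [B2 [E1 E2]]]]]]]]]].
  rewrite Hp0 in Hg.
  destruct (lift_exists _ _ _ L1 _ _ (concat g eta) (l1 0) (path_concat _ _ _ _ _ _ _ Hg Heta))
    as [m1 [Hm1 Hm10]]; [symmetry; apply B1 |].
  destruct (lift_exists _ _ _ L2 _ _ (concat g eta) (l2 0) (path_concat _ _ _ _ _ _ _ Hg Heta))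
    as [m2 [Hm2 Hm20]]; [rewrite Hbase; symmetry; apply B2 |].
  assert (Hglue : g 1 = eta 0).
  { destruct Hg as [_ [_ [_ ->]]], Heta as [_ [_ [-> _]]]; reflexivity. }
  assert (Hmid : forall (L : local_system G T t) l m r,
    is_lift L g l -> is_lift L (concat g eta) m -> m 0 = l 0 -> fib_rel (l 1) r e ->
    fib_rel (m (/ 2)) r e).
  { intros L l m r Hl Hm Hml Hl1; apply (fib_rel_trans2 _ _ _ _ _ (l 1)); [| exact Hl1].
    replace (/ 2) with (/ 2 * 1)%R by ring.
    apply (lift_fib_rel _ _ _ _ g (fun s => m (/ 2 * s)%R) l 0); auto;
      [exact (lift_half_l _ _ _ _ _ _ _ Hm) |].
    rewrite Rmult_0_r, Hml; apply fib_rel_refl. }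
  assert (Hend : forall (L : local_system G T t) j m,
    is_lift L (concat g eta) m -> (forall s, I01 s -> ls_cov L j (eta s)) ->
    ls_tv L j (m 1) = ls_tv L j (m (/ 2))).
  { intros L j m Hm Hj; replace 1 with (/ 2 * 1 + / 2)%R at 1 by field.
    replace (/ 2) with (/ 2 * 0 + / 2)%R at 3 by ring.
    apply (lift_in_chart _ _ _ _ eta (fun s => m (/ 2 * s + / 2)%R) j); auto.
    exact (lift_half_r _ _ _ _ _ _ _ Hglue Hm). }
  assert (M1 := Hmid L1 l1 m1 p0 H1 Hm1 Hm10 E1).
  assert (M2 := Hmid L2 l2 m2 q0 H2 Hm2 Hm20 E2).
  assert (F1 : ls_tv L1 i (m1 1) = e).
  { rewrite Hend by (auto; intros; apply HWsub, HWeta; assumption).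
    destruct M1 as [EM M1]; rewrite <- (gone_r G (ls_tv L1 i _)), <- M1; [exact Hp0e |].
    rewrite EM, Hp0; exact Hi. }
  assert (F2 : ls_tv L2 k (m2 1) = ls_tv L2 k q0).
  { rewrite Hend by (auto; intros; apply HWsub, HWeta; assumption).
    destruct M2 as [EM M2]; rewrite <- (gone_r G (ls_tv L2 k _)), <- M2; [reflexivity |].
    rewrite (lift_pr _ _ _ _ (concat g eta) m2) by auto.
    rewrite concat_l by lra; replace (2 * / 2)%R with 1 by field.
    destruct Hg as [_ [_ [_ ->]]]; exact Hk. }
  assert (Hm1p : ls_pr L1 (m1 1) = ls_pr L1 p).
  { rewrite (lift_pr _ _ _ _ (concat g eta) m1), concat_1 by auto; apply Heta. }
  assert (Htr : transported (m1 1) (m2 1)).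
  { exists (concat g eta), m1, m2, h; rewrite Hm1p.
    split; [eapply path_concat; eauto |]; rewrite Hm10, Hm20.
    repeat (split; [assumption || apply fib_rel_refl |]); apply fib_rel_refl. }
  destruct (fib_rel_ex _ _ _ L1 _ _ Hm1p) as [b Hb].
  destruct (fib_rel_act _ _ _ L2 (m2 1) b) as [q1 Hq1].
  assert (Htr' := transported_act _ _ _ _ b Htr Hb Hq1).
  assert (Hqq := transported_unique _ _ _ Htr' Hpq).
  assert (HWi := HWsub _ HWp); destruct HWi as [HWi HWk].
  destruct Hqq as [Eq Hqq]; destruct Hb as [Eb Hb]; destruct Hq1 as [Eq1 Hq1].
  assert (Hkq : ls_cov L2 k (ls_pr L2 q1)).
  { rewrite <- (transported_pr _ _ Htr'); exact HWk. }
  rewrite Hqq, gone_r by exact Hkq; rewrite Hq1 by (rewrite Eq1; exact Hkq).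
  rewrite F2, Hb, F1, gone_l by (rewrite Hm1p; exact HWi); reflexivity.
Qed.

End Transport.

Arguments transported {G T t L1 L2}.

Lemma transported_sym (G : Group) (T : tiling_t) (t : R) (L1 L2 : local_system G T t)
  (p1 : ls_pt L1) (p2 : ls_pt L2) (p : ls_pt L1) (q : ls_pt L2) :
  ls_pr L1 p1 = ls_pr L2 p2 -> transported p1 p2 p q -> transported p2 p1 q p.
Proof.
  intros Hbase H; assert (Hpr := transported_pr _ _ _ _ _ _ _ _ _ H).
  destruct H as [g [l1 [l2 [h [Hg H]]]]]; exists g, l2, l1, h.
  rewrite <- Hbase, <- Hpr; tauto.
Qed.

(** In charts [f] is left multiplication by a locally constant element, so it commutes with right
    translation and sends lifts to lifts. *)
Lemma hol_map (G : Group) (T : tiling_t) (t : R) (L1 L2 : local_system G T t)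
  (f : ls_pt L1 -> ls_pt L2) (p1 : ls_pt L1) (g : R -> set E) (a : G) :
  (forall p, ls_pr L2 (f p) = ls_pr L1 p) ->
  (forall i k C, isK T t C -> ls_cov L1 i C -> ls_cov L2 k C ->
     exists V c, openK T t V /\ V C /\ forall p, V (ls_pr L1 p) ->
       ls_cov L1 i (ls_pr L1 p) -> ls_cov L2 k (ls_pr L1 p) ->
       ls_tv L2 k (f p) = gmul G c (ls_tv L1 i p)) ->
  loopK T t (ls_pr L1 p1) g -> hol L1 p1 g a -> hol L2 (f p1) g a.
Proof.
  intros Hpr Hloc Hg [l [Hl [Hl0 Hl1]]].
  assert (Hrel : forall p q c, fib_rel p q c -> fib_rel (f p) (f q) c).
  { intros p q c [Epq Hpq]; split; [rewrite !Hpr; exact Epq |]; intros k Hk.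
    rewrite Hpr in Hk; assert (HK := ls_isK _ _ _ L1 p).
    destruct (ls_all _ _ _ L1 _ HK) as [i Hi].
    destruct (Hloc i k _ HK Hi Hk) as [V [b [_ [HV H]]]].
    rewrite (H q), (H p), Hpq, gassoc by (rewrite <- ?Epq; assumption); reflexivity. }
  exists (fun s => f (l s)); split; [| split; apply Hrel; assumption].
  intros s Hs; destruct (Hl s Hs) as [Hps Hls]; split; [rewrite Hpr; exact Hps |].
  intros k Hk; destruct Hg as [HK [Hc _]].
  destruct (ls_all _ _ _ L1 _ (HK s Hs)) as [i Hi].
  destruct (Hls i Hi) as [d [Hd HH]].
  destruct (Hloc i k _ (HK s Hs) Hi Hk) as [V [b [HVo [HV H]]]].
  destruct (Hc _ (openK_inter T t V _ HVo (ls_open _ _ _ L2 k)) s Hs (conj HV Hk))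
    as [d' [Hd' HH']].
  exists (Rmin d d'); split; [apply Rmin_glb_lt; lra |]; intros s' Hs' Hsd.
  pose proof (Rmin_l d d'); pose proof (Rmin_r d d').
  destruct (HH s' Hs') as [Hi' E1]; [lra |]; destruct (HH' s' Hs') as [HV' Hk']; [lra |].
  pose proof (lift_pr _ _ _ _ g l s' Hl Hs').
  split; [exact Hk' |]; rewrite !H by congruence; congruence.
Qed.

(** * From bundles to local systems *)

Arguments tot {G T t}. Arguments opn {G T t}. Arguments proj {G T t}. Arguments act {G T t}.
Arguments Idx {G T t}. Arguments cov {G T t}. Arguments triv {G T t}.

Lemma PE_open_mono (T : tiling_t) (r t : R) (U : set pt) :
  r <= t -> PE_open T r U -> PE_open T t U.
Proof.
  intros Hr [HU H]; split; [exact HU |]; intros x y Hx Hxy; apply (H x); auto.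
  apply (simE_mono r t); auto.
Qed.

Section Image.
Variables (T : tiling_t) (t : R) (U : set pt).
Hypothesis HU : PE_open T t U.

Definition imK (C : set E) : Prop := exists x, C = piK T t x /\ U x.

Lemma imK_piK (x : pt) : imK (piK T t x) <-> U x.
Proof.
  split; [| intro Hx; exists x; auto].
  intros [y [Hxy Hy]]; destruct HU as [_ H]; apply (H y); auto.
  apply piK_eq; auto.
Qed.

Lemma imK_open : openK T t imK.
Proof.
  apply openR2_openK; intros x Hx; rewrite imK_piK in Hx.
  destruct HU as [Ho _]; destruct (Ho x Hx) as [d [Hd H]]; exists d; split; [exact Hd |].
  intros y Hy; rewrite imK_piK; auto.
Qed.
End Image.

Section Bundle.
Variables (G : Group) (T : tiling_t) (r : R) (b : FlatPEBundle G T r).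

Lemma triv_inj (i : Idx b) (p q : tot b) :
  cov b i (proj b p) -> proj b p = proj b q -> triv b i p = triv b i q -> p = q.
Proof.
  intros Hi Hpq Ht; destruct (triv_bij _ _ _ b i (proj b p) (triv b i p) Hi) as [z [_ [_ H]]].
  transitivity z; [apply H | symmetry; apply H]; auto.
Qed.

Lemma triv_ex (i : Idx b) (x : pt) (g : G) :
  cov b i x -> exists p, proj b p = x /\ triv b i p = g.
Proof.
  intros Hi; destruct (triv_bij _ _ _ b i x g Hi) as [p [Hp [Ht _]]]; eauto.
Qed.

(** The charts determine the topology: an open set contains, with each of its points, the nearby
    part of the sheet through that point. *)
Lemma opn_iff (W : set (tot b)) : opn b W <->
  forall p, W p -> forall i, cov b i (proj b p) -> exists d, 0 < d /\
    forall q, cov b i (proj b q) -> dist (proj b p) (proj b q) < d ->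
      triv b i q = triv b i p -> W q.
Proof.
  split.
  - intros HW p Hp i Hi; destruct (cov_PE _ _ _ b i) as [Ho _].
    pose proof (opn_I _ _ _ b _ _ HW (proj_cont _ _ _ b _ Ho)) as HWi.
    apply (triv_homeo _ _ _ b i) in HWi; [| tauto].
    destruct (HWi (triv b i p) (proj b p)) as [d [Hd H]]; [exists p; auto |].
    exists d; split; [exact Hd |]; intros q Hq Hpq Htq.
    destruct (H (proj b q) Hpq) as [p' [[HWp' Hcp'] [Hp' Ht']]]; simpl in *.
    replace q with p'; [exact HWp' | apply (triv_inj i); congruence].
  - intro H.
    (* [W] is the union of its parts over the charts, to each of which [triv_homeo] applies. *)
    replace W with (fun p => exists Z, (exists i, Z = fun p => W p /\ cov b i (proj b p)) /\ Z p).
    + apply (opn_U _ _ _ b (fun Z => exists i, Z = fun p => W p /\ cov b i (proj b p))).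
      intros Z [i ->]; apply (triv_homeo _ _ _ b i); [tauto |].
      intros g x [p [[HWp Hip] [Hpx Htp]]]; simpl in *; subst x g.
      destruct (H p HWp i Hip) as [d [Hd Hq]].
      destruct (cov_PE _ _ _ b i) as [Ho _]; destruct (Ho _ Hip) as [d' [Hd' Hq']].
      exists (Rmin d d'); split; [apply Rmin_glb_lt; lra |]; intros y Hy.
      pose proof (Rmin_l d d'); pose proof (Rmin_r d d').
      destruct (triv_ex i y (triv b i p)) as [q [Hqy Htq]]; [apply Hq'; lra |].
      assert (cov b i (proj b q)) by (rewrite Hqy; apply Hq'; lra).
      exists q; repeat split; auto; apply Hq; auto; rewrite Hqy; lra.
    + apply set_ext; intro p; split; [intros [Z [[i ->] [Hp _]]]; exact Hp |].
      intro Hp; destruct (cov_all _ _ _ b (proj b p)) as [i Hi].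
      exists (fun p => W p /\ cov b i (proj b p)); split; [exists i; reflexivity | split; assumption].
Qed.

Variable t : R.
Hypothesis Hrt : r <= t.

Let Hcov (i : Idx b) : PE_open T t (cov b i) := PE_open_mono T r t _ Hrt (cov_PE _ _ _ b i).

(** The total space stays that of the bundle over the plane; only the projection is composed with
    the map to K_t. The definition is transparent so that points and chart values reduce to those of
    [b]. *)
Definition bundle_system : local_system G T t.
Proof.
  refine {| ls_pt := tot b; ls_idx := Idx b; ls_pr := fun p => piK T t (proj b p);
            ls_cov := fun i => imK T t (cov b i); ls_tv := triv b |}.
  - intro p; apply isK_piK.
  - intro i; apply imK_open, Hcov.
  - intros C HC; destruct (isK_point _ _ _ HC) as [x ->].
    destruct (cov_all _ _ _ b x) as [i Hi]; exists i, x; auto.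
  - intros i C g _ [x [-> Hx]]; destruct (triv_ex i x g Hx) as [p [<- Hp]]; exists p; auto.
  - intros i j C _ [x [-> Hi]] Hj; rewrite imK_piK in Hj by apply Hcov.
    destruct (trans _ _ _ b) as [h [Hh [HPE Hloc]]].
    (* The set where the transition function keeps its value at [x] is open by local constancy and
       saturated by the PE condition, hence comes from an open set of K_t. *)
    assert (HU : PE_open T t (fun y => cov b i y /\ cov b j y /\ h j i y = h j i x)).
    { destruct (Hcov i) as [Hio Hip], (Hcov j) as [Hjo Hjp]; split.
      - intros y [Hiy [Hjy Hhy]]; destruct (Hloc i j y Hiy Hjy) as [d [Hd H]].
        destruct (openR2_inter _ _ Hio Hjo y (conj Hiy Hjy)) as [d' [Hd' H']].
        exists (Rmin d d'); split; [apply Rmin_glb_lt; lra |]; intros z Hz.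
        pose proof (Rmin_l d d'); pose proof (Rmin_r d d').
        destruct (H' z) as [Hiz Hjz]; [lra |].
        rewrite H by (auto; lra); auto.
      - intros y z [Hiy [Hjy Hhy]] Hyz; specialize (Hip y z Hiy Hyz); specialize (Hjp y z Hjy Hyz).
        split; [exact Hip |]; split; [exact Hjp |]; rewrite <- Hhy; symmetry; apply HPE; auto.
        apply (simE_mono r t); auto. }
    exists (imK T t (fun y => cov b i y /\ cov b j y /\ h j i y = h j i x)), (h j i x).
    split; [apply imK_open, HU |]; split; [apply imK_piK; auto |].
    intros p Hp _ _; rewrite imK_piK in Hp by exact HU; destruct Hp as [Hip [Hjp <-]].
    apply Hh; auto.
Defined.

Lemma bundle_cov (i : Idx b) (x : pt) : ls_cov bundle_system i (piK T t x) <-> cov b i x.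
Proof. apply imK_piK, Hcov. Qed.

Lemma fib_rel_proj_eq (p q : ls_pt bundle_system) :
  fib_rel p q (gone G) -> proj b p = proj b q -> p = q.
Proof.
  intros [_ H] Hpq; destruct (cov_all _ _ _ b (proj b p)) as [i Hi]; apply (triv_inj i); auto.
  symmetry; rewrite <- (gone_r G (triv b i p)); apply H, bundle_cov, Hi.
Qed.

Lemma fib_rel_act_bundle (p : ls_pt bundle_system) (g : G) : fib_rel p (act b p g) g.
Proof.
  split; simpl; [rewrite proj_act; reflexivity |]; intros i Hi.
  apply triv_eqv; apply bundle_cov, Hi.
Qed.

(** Moves a representative to a prescribed point of the plane, which makes the isomorphism of
    [hol_based_iso] cover the identity. *)
Lemma fib_rel_over (p : ls_pt bundle_system) (x : pt) :
  piK T t (proj b p) = piK T t x -> exists q, proj b q = x /\ fib_rel p q (gone G).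
Proof.
  intro Hpx; destruct (cov_all _ _ _ b x) as [i Hi].
  destruct (triv_ex i x (triv b i p) Hi) as [q [Hq Ht]]; exists q; split; [exact Hq |].
  apply (fib_rel_chart _ _ _ bundle_system i); simpl.
  - rewrite Hq; exact Hpx.
  - rewrite Hpx; apply imK_piK; auto.
  - rewrite gone_r; exact Ht.
Qed.

End Bundle.

Arguments bundle_system {G T r} b {t} Hrt.

(** * Based isomorphisms and equality of holonomy *)

Section Isomorphism.
Variables (G : Group) (T : tiling_t) (x0 : pt) (B1 B2 : BasedBundle G T x0) (t : R).
Hypotheses (H1 : brad G T x0 B1 <= t) (H2 : brad G T x0 B2 <= t).
Local Notation b1 := (bbun G T x0 B1).
Local Notation b2 := (bbun G T x0 B2).
Local Notation L1 := (bundle_system b1 H1).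
Local Notation L2 := (bundle_system b2 H2).
Local Notation p1 := (bpt0 G T x0 B1).
Local Notation p2 := (bpt0 G T x0 B2).
Local Infix "*" := (gmul G).
Local Notation inv := (ginv G).
Local Notation tr12 := (transported (L1 := L1) (L2 := L2) p1 p2).
Local Notation tr21 := (transported (L1 := L2) (L2 := L1) p2 p1).

Lemma based_iso_hol (s : R) (g : R -> set E) (a : G) :
  s <= t -> based_iso G T x0 s B1 B2 -> loopK T t (piK T t x0) g ->
  hol L1 p1 g a -> hol L2 p2 g a.
Proof.
  intros Hst [phi [Hproj [Hact [Hinj [Hsurj [Hopn [Hbase Hexpr]]]]]]] Hg.
  rewrite <- Hbase; rewrite <- (bpt0_fib _ _ _ B1) in Hg.
  apply (hol_map G T t L1 L2 phi p1 g a); [| | exact Hg].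
  { intro p; simpl; rewrite Hproj; reflexivity. }
  intros i k C _ [x [-> Hi]] Hk; apply bundle_cov in Hk; simpl in i, k.
  set (expr := fun q => triv b2 k (phi q) * inv (triv b1 i q)).
  (* The PE condition applied to a point related to itself: [expr] depends only on the
     projection. *)
  assert (Hfib : forall q q', cov b1 i (proj b1 q) -> cov b2 k (proj b1 q) ->
    proj b1 q = proj b1 q' -> expr q = expr q').
  { intros q q' Hqi Hqk Hqq; apply Hexpr; rewrite <- ?Hqq; auto; apply simE_refl. }
  destruct (triv_ex _ _ _ b1 i x (gone G) Hi) as [p0 [Hp0 Hp01]].
  set (U := fun y => cov b1 i y /\ cov b2 k y /\ exists q, proj b1 q = y /\ expr q = expr p0).
  assert (HU : PE_open T t U).
  { destruct (cov_PE _ _ _ b1 i) as [Hio Hip], (cov_PE _ _ _ b2 k) as [Hko Hkp]; split.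
    - intros y [Hiy [Hky [q [Hq Hqe]]]]; subst y.
      (* Local constancy of [expr] comes from the topology. The sheet of chart [i] through [q] is
         open, so its image under [phi] is open and contains a piece of the sheet of chart [k]
         through [phi q]. *)
      assert (HW : opn b1 (fun p => cov b1 i (proj b1 p) /\ triv b1 i p = triv b1 i q)).
      { apply (triv_homeo _ _ _ b1 i); [tauto |]; intros g0 y [p [[Hpi Hpt] [Hpy Hpg]]]; simpl in *.
        subst y g0; destruct (Hio _ Hpi) as [d [Hd HH]]; exists d; split; [exact Hd |].
        intros y Hy; destruct (triv_ex _ _ _ b1 i y (triv b1 i p) (HH y Hy)) as [p' [Hp' Ht']].
        exists p'; simpl; rewrite Hp', Ht'; auto. }
      apply Hopn in HW; rewrite opn_iff in HW.
      destruct (HW (phi q)) with (i := k) as [d [Hd HH]]; [exists q; auto | rewrite Hproj; exact Hky |].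
      destruct (openR2_inter _ _ Hio Hko _ (conj Hiy Hky)) as [d' [Hd' HH']].
      exists (Rmin d d'); split; [apply Rmin_glb_lt; lra |]; intros z Hz.
      pose proof (Rmin_l d d'); pose proof (Rmin_r d d').
      destruct (HH' z) as [Hiz Hkz]; [lra |]; split; [exact Hiz |]; split; [exact Hkz |].
      destruct (triv_ex _ _ _ b2 k z (triv b2 k (phi q)) Hkz) as [q2 [Hq2 Htq2]].
      destruct (HH q2) as [p' [[Hp'i Hp't] Hp'q]];
        [rewrite Hq2; exact Hkz | rewrite Hq2, Hproj; lra | exact Htq2 |].
      exists p'; split; [rewrite <- Hproj, Hp'q; exact Hq2 |].
      rewrite <- Hqe; unfold expr; rewrite Hp'q, Hp't, Htq2; reflexivity.
    - intros y z [Hiy [Hky [q [Hq Hqe]]]] Hyz.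
      assert (Hiz : cov b1 i z) by (apply (Hip y); auto; apply (simE_mono _ t); auto).
      assert (Hkz : cov b2 k z) by (apply (Hkp y); auto; apply (simE_mono _ t); auto).
      split; [exact Hiz |]; split; [exact Hkz |].
      destruct (triv_ex _ _ _ b1 i z (gone G) Hiz) as [q' [Hq' _]]; exists q'; split; [exact Hq' |].
      rewrite <- Hqe; symmetry; apply Hexpr; rewrite ?Hq, ?Hq'; auto.
      apply (simE_mono _ t); auto. }
  exists (imK T t U), (expr p0); split; [apply imK_open, HU |]; split.
  { apply imK_piK; [exact HU |]; split; [exact Hi |]; split; [exact Hk |]; exists p0; auto. }
  intros p HpU _ _; apply imK_piK in HpU; [| exact HU].
  destruct HpU as [Hpi [Hpk [q [Hq <-]]]].
  rewrite (Hfib q p) by (rewrite ?Hq; auto); unfold expr.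
  rewrite <- gassoc, ginv_l, gone_r; reflexivity.
Qed.

Lemma hol_based_iso :
  path_connectedK T t -> loc_path_connectedK T t ->
  (forall g a, loopK T t (piK T t x0) g -> hol L1 p1 g a <-> hol L2 p2 g a) ->
  based_iso G T x0 t B1 B2.
Proof.
  intros Hpc Hlpc Hhol.
  assert (E1 : ls_pr L1 p1 = piK T t x0) by (simpl; rewrite bpt0_fib; reflexivity).
  assert (E2 : ls_pr L2 p2 = piK T t x0) by (simpl; rewrite bpt0_fib; reflexivity).
  assert (Hbase : ls_pr L1 p1 = ls_pr L2 p2) by congruence.
  assert (Huniq : forall p q q', tr12 p q -> tr12 p q' ->
    fib_rel (L := L2) q q' (gone G)).
  { apply transported_unique; intros g a Hg; rewrite E1 in Hg; apply Hhol, Hg. }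
  assert (Huniq' : forall q p p', tr21 q p -> tr21 q p' ->
    fib_rel (L := L1) p p' (gone G)).
  { apply transported_unique; intros g a Hg; rewrite E2 in Hg; apply Hhol, Hg. }
  assert (Hloc := fun i k C => transported_local G T t L1 L2 p1 p2 Hbase
    (fun g a Hg => proj1 (Hhol g a (eq_ind _ (fun C => loopK T t C g) Hg _ E1))) i k C Hpc Hlpc).
  (* Transport determines a point of the covering of K_t only; requiring equal projections to the
     plane selects its representative. *)
  destruct (choice_fun (tot b1) (tot b2) (fun p q => tr12 p q /\ proj b2 q = proj b1 p))
    as [phi Hphi].
  { intro p; destruct (transported_exists _ _ _ L1 L2 p1 p2 Hbase p Hpc) as [q Hq].
    destruct (fib_rel_over _ _ _ b2 t H2 q (proj b1 p)) as [q' [Hq' Hr]].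
    { symmetry; apply (transported_pr _ _ _ _ _ _ _ _ _ Hq). }
    exists q'; split; [| exact Hq'].
    apply (transported_act G T t L1 L2 p1 p2 p p q q' (gone G)); auto; apply fib_rel_refl. }
  assert (Hproj : forall p, proj b2 (phi p) = proj b1 p) by apply Hphi.
  assert (Hphi_uniq : forall p q, tr12 p q -> proj b2 q = proj b1 p -> phi p = q).
  { intros p q Hq Hpq; apply (fib_rel_proj_eq _ _ _ b2 t H2); [| rewrite Hproj; auto].
    apply (Huniq p); auto; apply Hphi. }
  assert (Hinj : forall p q, phi p = phi q -> p = q).
  { intros p q Hpq; apply (fib_rel_proj_eq _ _ _ b1 t H1).
    - apply (Huniq' (phi p)); apply transported_sym; auto; [| rewrite Hpq]; apply Hphi.
    - rewrite <- !Hproj, Hpq; reflexivity. }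
  assert (Hsurj : forall q, exists p, phi p = q).
  { intro q; destruct (transported_exists _ _ _ L2 L1 p2 p1 (eq_sym Hbase) q Hpc) as [p Hp].
    destruct (fib_rel_over _ _ _ b1 t H1 p (proj b2 q)) as [p' [Hp' Hr]].
    { symmetry; apply (transported_pr _ _ _ _ _ _ _ _ _ Hp). }
    exists p'; apply Hphi_uniq; [| auto].
    apply transported_sym; auto.
    apply (transported_act G T t L2 L1 p2 p1 q q p p' (gone G)); auto; apply fib_rel_refl. }
  assert (Hnear : forall p i k, cov b1 i (proj b1 p) -> cov b2 k (proj b1 p) ->
    exists d c, 0 < d /\ forall q, dist (proj b1 p) (proj b1 q) < d ->
      cov b1 i (proj b1 q) /\ cov b2 k (proj b1 q) /\ triv b2 k (phi q) = c * triv b1 i q).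
  { intros p i k Hi Hk.
    destruct (Hloc i k (piK T t (proj b1 p))) as [W [c [HW [HWp H]]]];
      [apply isK_piK | apply bundle_cov; assumption .. |].
    destruct (cov_PE _ _ _ b1 i) as [Hio _], (cov_PE _ _ _ b2 k) as [Hko _].
    destruct (openR2_inter _ _ (openR2_inter _ _ Hio Hko) (openK_openR2 _ _ _ HW) _
      (conj (conj Hi Hk) HWp)) as [d [Hd HH]].
    exists d, c; split; [exact Hd |]; intros q Hq; destruct (HH _ Hq) as [[Hqi Hqk] HqW].
    split; [exact Hqi |]; split; [exact Hqk |]; apply (H q (phi q)); [apply Hphi | exact HqW]. }
  assert (Hself : forall p d, 0 < d -> dist (proj b1 p) (proj b1 p) < d).
  { intros p d Hd; rewrite dist_refl; exact Hd. }
  exists phi; split; [exact Hproj |]; split; [| split; [exact Hinj |]; split; [exact Hsurj |]; split; [| split]].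
  - intros p g; apply Hphi_uniq.
    + apply (transported_act G T t L1 L2 p1 p2 p _ (phi p) _ g); [apply Hphi | apply fib_rel_act_bundle ..].
    + rewrite !proj_act; apply Hproj.
  - intro W; rewrite !opn_iff; split.
    + intros HW q [p [HWp <-]] k Hk; rewrite Hproj in Hk.
      destruct (cov_all _ _ _ b1 (proj b1 p)) as [i Hi].
      destruct (HW p HWp i Hi) as [d [Hd HH]], (Hnear p i k Hi Hk) as [d' [c [Hd' HH']]].
      exists (Rmin d d'); split; [apply Rmin_glb_lt; lra |]; intros q Hq Hpq Ht.
      pose proof (Rmin_l d d'); pose proof (Rmin_r d d').
      destruct (Hsurj q) as [p' <-]; exists p'; split; [| reflexivity].
      rewrite !Hproj in Hpq; destruct (HH' p') as [Hp'i [_ Hp'c]]; [lra |].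
      destruct (HH' p) as [_ [_ Hpc']]; [auto |].
      apply HH; [exact Hp'i | lra |]; apply (gmul_cancel_l G c); congruence.
    + intros HW p HWp i Hi; destruct (cov_all _ _ _ b2 (proj b1 p)) as [k Hk].
      destruct (HW (phi p)) with (i := k) as [d [Hd HH]];
        [exists p; auto | rewrite Hproj; exact Hk |].
      destruct (Hnear p i k Hi Hk) as [d' [c [Hd' HH']]].
      exists (Rmin d d'); split; [apply Rmin_glb_lt; lra |]; intros p' _ Hpp Ht.
      pose proof (Rmin_l d d'); pose proof (Rmin_r d d').
      destruct (HH' p') as [_ [Hp'k Hp'c]]; [lra |]; destruct (HH' p) as [_ [_ Hpc']]; [auto |].
      destruct (HH (phi p')) as [p'' [Hp'' E]]; [rewrite Hproj; exact Hp'k | rewrite !Hproj; lra | congruence |].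
      rewrite <- (Hinj _ _ E); exact Hp''.
  - apply Hphi_uniq; [apply transported_base, Hbase |]; rewrite !bpt0_fib; reflexivity.
  (* Related points have the same image in K_t, so one neighbourhood [W] and one constant [c] serve
     both. *)
  - intros i k p q Hpi Hpk Hqi Hqk Hpq.
    destruct (Hloc i k (piK T t (proj b1 p))) as [W [c [_ [HWp H]]]];
      [apply isK_piK | apply bundle_cov; assumption .. |].
    assert (F1 : triv b2 k (phi p) = c * triv b1 i p).
    { apply (H p (phi p)); [apply Hphi | exact HWp]. }
    assert (F2 : triv b2 k (phi q) = c * triv b1 i q).
    { apply (H q (phi q)); [apply Hphi |]; simpl.
      replace (piK T t (proj b1 q)) with (piK T t (proj b1 p)); [exact HWp |].
      apply piK_eq, Hpq. }
    rewrite F1, F2, <- !gassoc, !ginv_r; reflexivity.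
Qed.
End Isomorphism.

(** One function [l] into the total space is a lift at both levels: the chart sets are PE for both
    radii, and chart values do not involve the radius. *)
Lemma bundle_hol_fmap (G : Group) (T : tiling_t) (x0 : pt) (tr : nat -> R)
  (Hmono : forall n, tr n <= tr (S n)) (B : BasedBundle G T x0) (n k : nat)
  (Hn : brad G T x0 B <= tr n) (Hk : brad G T x0 B <= tr k) (g : R -> set E) (a : G) :
  (n <= k)%nat ->
  hol (bundle_system (bbun G T x0 B) Hk) (bpt0 G T x0 B) g a ->
  hol (bundle_system (bbun G T x0 B) Hn) (bpt0 G T x0 B)
    (fun s => fmap T tr n (k - n) (g s)) a.
Proof.
  intros Hnk [l [Hl [Hl0 Hl1]]].
  assert (Hrel : forall p q c,
    fib_rel (L := bundle_system (bbun G T x0 B) Hk) p q c ->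
    fib_rel (L := bundle_system (bbun G T x0 B) Hn) p q c).
  { intros p q c [Epq Hpq]; simpl in *; split; simpl.
    - rewrite <- !(fmap_piK T tr Hmono n k), Epq by exact Hnk; reflexivity.
    - intros i Hi; apply Hpq; rewrite imK_piK in * by
        (eapply PE_open_mono; [eassumption | apply cov_PE]); exact Hi. }
  exists l; split; [| split; apply Hrel; assumption].
  intros s Hs; destruct (Hl s Hs) as [Hp H]; simpl in *; rewrite <- Hp, fmap_piK by assumption.
  split; [reflexivity |]; intros i Hi.
  assert (Hik : imK T (tr k) (cov (bbun G T x0 B) i) (g s)).
  { rewrite <- Hp, imK_piK in * by (eapply PE_open_mono; [eassumption | apply cov_PE]); exact Hi. }
  destruct (H i Hik) as [d [Hd HH]]; exists d; split; [exact Hd |]; intros s' Hs' Hsd.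
  destruct (HH s' Hs' Hsd) as [Hi' Ht]; split; [| exact Ht].
  destruct (Hl s' Hs') as [Hp' _]; simpl in Hp'; rewrite <- Hp', fmap_piK by assumption.
  rewrite <- Hp', imK_piK in Hi' by (eapply PE_open_mono; [exact Hk | apply cov_PE]).
  apply imK_piK; [eapply PE_open_mono; [exact Hn | apply cov_PE] | exact Hi'].
Qed.

(** * Transport defined by a representation *)

Ltac case_Rle := repeat match goal with
  | |- context [Rle_dec ?a ?b] => destruct (Rle_dec a b)
  end.

Ltac piecewise_reparam K :=
  split;
  [ intros s [? ?]; unfold I01; case_Rle; lra
  | exists K; split; [lra |]; intros r s [? ?] [? ?]; case_Rle;
    unfold Rabs; repeat destruct Rcase_abs; lra ].

Lemma reparam_id : reparam (fun s => s).
Proof. piecewise_reparam 1. Qed.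

Lemma concat_ext (g g' h h' : R -> set E) :
  (forall s, I01 s -> g s = g' s) -> (forall s, I01 s -> h s = h' s) ->
  forall s, I01 s -> concat g h s = concat g' h' s.
Proof.
  intros Hg Hh s [Hs0 Hs1]; unfold concat; destruct Rle_dec; [apply Hg | apply Hh]; split; lra.
Qed.

Lemma rev_ext (g g' : R -> set E) :
  (forall s, I01 s -> g s = g' s) -> forall s, I01 s -> rev_path g s = rev_path g' s.
Proof. intros Hg s [Hs0 Hs1]; apply Hg; split; lra. Qed.

Lemma rev_concat (g h : R -> set E) (s : R) : g 1 = h 0 ->
  rev_path (concat g h) s = concat (rev_path h) (rev_path g) s.
Proof.
  intro Hgh; unfold rev_path at 1; destruct (Rle_dec s (/ 2)).
  - rewrite concat_r, concat_l by (auto; lra); unfold rev_path; f_equal; ring.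
  - rewrite concat_l, (concat_r (rev_path h)) by
      (rewrite ?rev_path_0, ?rev_path_1; auto; lra).
    unfold rev_path; f_equal; ring.
Qed.

Lemma concat_const (C : set E) : concat (const_path C) (const_path C) = const_path C.
Proof. apply functional_extensionality; intro s; unfold concat; destruct Rle_dec; reflexivity. Qed.

Section Representation.
Variables (G : Group) (T : tiling_t) (t : R) (b : set E) (rho : (R -> set E) -> G).
Hypotheses (Hb : isK T t b) (Hrho : isHom G T t b rho).
Local Infix "*" := (gmul G).
Local Notation e := (gone G).
Local Notation path := (pathK T t).

Lemma rho_family (H : R -> R -> set E) (g0 g1 : R -> set E) :
  family T t H -> (forall u, I01 u -> H u 0 = b /\ H u 1 = b) ->
  (forall s, I01 s -> g0 s = H 0 s) -> (forall s, I01 s -> g1 s = H 1 s) ->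
  rho g0 = rho g1.
Proof.
  intros HH Hends H0 H1; apply Hrho.
  - apply (pathK_ext _ _ _ _ (H 0)); [intros; symmetry; auto |].
    apply family_path; auto; apply Hends; auto.
  - apply (pathK_ext _ _ _ _ (H 1)); [intros; symmetry; auto |].
    apply family_path; auto; apply Hends; auto.
  - destruct HH as [HK Hc]; exists H; split; [exact HK |]; split; [exact Hc |].
    split; [intros; split; symmetry; auto | exact Hends].
Qed.

Lemma rho_ext (g g' : R -> set E) : path b b g -> (forall s, I01 s -> g' s = g s) -> rho g' = rho g.
Proof.
  intros Hg Heq; apply (rho_family (fun _ => g)); auto; [eapply path_family; eauto |].
  intros _ _; split; apply Hg.
Qed.

Lemma rho_reparam (g g' : R -> set E) (phi : R -> R) : path b b g -> reparam phi ->
  phi 0 = 0 -> phi 1 = 1 -> (forall s, I01 s -> g' s = g (phi s)) -> rho g' = rho g.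
Proof.
  intros Hg Hphi H0 H1 Heq.
  apply (rho_family (fun u s => g ((1 - u) * phi s + u * s)%R)).
  - apply (family_interpolate T t b b g phi (fun s => s)); auto; apply reparam_id.
  - intros u _; rewrite H0, H1; destruct Hg as [_ [_ [G0 G1]]].
    split; [rewrite <- G0 | rewrite <- G1]; f_equal; ring.
  - intros s Hs; rewrite Heq by exact Hs; f_equal; ring.
  - intros s Hs; f_equal; ring.
Qed.

(* Transport along [al] relative to transport along [be], for two paths from [b] to one point. *)
Definition holD (al be : R -> set E) : G := rho (concat al (rev_path be)).

Lemma holD_ext (C : set E) (al al' be be' : R -> set E) : path b C al -> path b C be ->
  (forall s, I01 s -> al' s = al s) -> (forall s, I01 s -> be' s = be s) ->
  holD al' be' = holD al be.
Proof.
  intros Hal Hbe Ha Hb'; apply rho_ext.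
  - eapply path_concat; [exact Hal | apply path_rev, Hbe].
  - apply concat_ext; [exact Ha | apply rev_ext, Hb'].
Qed.

(** A pause in the middle of a loop makes room for the spurs that [holD_trans] and [holD_cancel]
    grow there. *)
Lemma rho_hold (C : set E) (al om : R -> set E) : path b C al -> path C b om ->
  rho (concat (concat al (const_path C)) (concat (const_path C) om)) = rho (concat al om).
Proof.
  intros Hal Hom.
  set (phi := fun s => if Rle_dec s (/ 4) then (2 * s)%R else if Rle_dec s (3 / 4) then / 2 else (2 * s - 1)%R).
  assert (Ha1 : al 1 = C) by apply Hal.
  assert (Ho0 : om 0 = C) by apply Hom.
  apply (rho_reparam _ _ phi); [eapply path_concat; eauto | unfold phi; piecewise_reparam 2 | | |].
  - unfold phi; case_Rle; lra.
  - unfold phi; case_Rle; lra.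
  - assert (Hglue : concat al (const_path C) 1 = concat (const_path C) om 0).
    { rewrite concat_0, concat_1; reflexivity. }
    intros s _; unfold phi; destruct (Rle_dec s (/ 4)); [| destruct (Rle_dec s (3 / 4))].
    + rewrite (concat_l (concat al _)), (concat_l al (const_path C)), (concat_l al om) by lra.
      f_equal; ring.
    + rewrite (concat_l al om) by lra; replace (2 * / 2)%R with 1 by field; rewrite Ha1.
      destruct (Rle_dec s (/ 2)).
      * rewrite (concat_l (concat al _)), (concat_r al (const_path C)) by (auto; lra); reflexivity.
      * rewrite (concat_r (concat al _)), (concat_l (const_path C) om) by (auto; lra); reflexivity.
    + rewrite (concat_r (concat al _)), (concat_r (const_path C) om), (concat_r al om)
        by (auto; congruence || lra).
      f_equal; ring.
Qed.

(* The homotopy retracts the spur that runs back and forth along [be]. *)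
Lemma holD_trans (C : set E) (al be ze : R -> set E) :
  path b C al -> path b C be -> path b C ze -> holD al be * holD be ze = holD al ze.
Proof.
  intros Hal Hbe Hze; unfold holD; destruct Hrho as [_ Hmul].
  assert (Hrbe := path_rev _ _ _ _ _ Hbe); assert (Hrze := path_rev _ _ _ _ _ Hze).
  rewrite <- Hmul by (eapply path_concat; eauto).
  rewrite <- (rho_hold C al (rev_path ze)) by auto; symmetry.
  assert (Ha1 : al 1 = C) by apply Hal.
  assert (Hb1 : be 1 = C) by apply Hbe.
  assert (Hz1 : ze 1 = C) by apply Hze.
  assert (Hsub : forall phi : R -> R -> R, phi = (fun u s => (1 - u * s)%R) \/
      phi = (fun u s => (1 - u * (1 - s))%R) -> family T t (fun u s => be (phi u s))).
  { intros phi Hphi; apply (family_compose T t b C); [exact Hbe | |].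
    - intros u s [Hu0 Hu1] [Hs0 Hs1]; destruct Hphi; subst phi; split; nra.
    - exists 1; split; [lra |]; intros u s u' s' [Hu0 Hu1] [Hs0 Hs1] [Hu'0 Hu'1] [Hs'0 Hs'1].
      rewrite Rmult_1_l; destruct Hphi; subst phi; cbv beta.
      + replace (1 - u' * s' - (1 - u * s))%R with ((u' - u) * (- s') + (s' - s) * (- u))%R by ring.
        eapply Rle_trans; [apply Rabs_triang |]; rewrite !Rabs_mult, !Rabs_Ropp, (Rabs_right s'), (Rabs_right u) by lra.
        pose proof (Rabs_pos (u' - u)); pose proof (Rabs_pos (s' - s)); nra.
      + replace (1 - u' * (1 - s') - (1 - u * (1 - s)))%R
          with ((u' - u) * (- (1 - s')) + (s' - s) * u)%R by ring.
        eapply Rle_trans; [apply Rabs_triang |]; rewrite !Rabs_mult, !Rabs_Ropp, (Rabs_right (1 - s')), (Rabs_right u) by lra.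
        pose proof (Rabs_pos (u' - u)); pose proof (Rabs_pos (s' - s)); nra. }
  (* At [u = 0] the two inner arcs rest at [C]; at [u = 1] they run back along all of [be] and out
     again. *)
  apply (rho_family (fun u => concat (concat al (fun s => be (1 - u * s)%R))
                        (concat (fun s => be (1 - u * (1 - s))%R) (rev_path ze)))).
  - apply family_concat; [apply family_concat | apply family_concat |];
      try (eapply path_family; eauto); try (apply (Hsub (fun u s => _)); auto);
      intros u _; cbv beta; rewrite ?concat_0, ?concat_1, ?rev_path_0, ?Ha1, ?Hz1, <- ?Hb1;
      f_equal; ring.
  - intros u _; rewrite !concat_0, !concat_1; split; [apply Hal | apply Hrze].
  - apply concat_ext; apply concat_ext; auto; intros s _; unfold const_path;
      rewrite Rmult_0_l, Rminus_0_r, Hb1; reflexivity.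
  - apply concat_ext; apply concat_ext; auto; intros s _; unfold rev_path; f_equal; ring.
Qed.

Lemma holD_self (C : set E) (al : R -> set E) : path b C al -> holD al al = e.
Proof. intro Hal; apply gmul_idem, (holD_trans C); assumption. Qed.

Lemma holD_inv (C : set E) (al be : R -> set E) :
  path b C al -> path b C be -> ginv G (holD al be) = holD be al.
Proof.
  intros Hal Hbe; apply ginv_unique; rewrite (holD_trans C) by assumption.
  apply (holD_self C), Hal.
Qed.

Lemma path_tail (a c : set E) (g : R -> set E) (r r' : R) : path a c g -> I01 r -> I01 r' ->
  path (g r) (g r') (fun s => g (r + (r' - r) * s)%R).
Proof.
  intros Hg [Hr0 Hr1] [Hr'0 Hr'1].
  assert (H := path_reparam T t a c g (fun s => (r' - r) * s + r)%R Hg).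
  cbv beta in H; replace ((r' - r) * 0 + r)%R with r in H by ring.
  replace ((r' - r) * 1 + r)%R with r' in H by ring.
  eapply pathK_ext; [| apply H, reparam_affine; split; lra].
  intros s _; cbv beta; f_equal; ring.
Qed.

(** The common tail is grown from nothing as [et (u * s)], run forward and then backward between
    [al] and the reverse of [be]. *)
Lemma holD_cancel (C C' : set E) (al be et : R -> set E) :
  path b C al -> path b C be -> path C C' et ->
  holD (concat al et) (concat be et) = holD al be.
Proof.
  intros Hal Hbe Het; unfold holD.
  assert (Ha1 : al 1 = C) by apply Hal.
  assert (Hb1 : be 1 = C) by apply Hbe.
  assert (He0 : et 0 = C) by apply Het.
  assert (HC : isK T t C) by (eapply pathK_isK_r; eauto).
  rewrite <- (rho_hold C al (rev_path be)) by (auto; eapply path_rev; eauto); symmetry.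
  assert (Hfam : family T t (fun u s => et (u * s)%R)).
  { apply (family_compose T t C C' et (fun u s => u * s)%R Het).
    - intros; apply I01_mult; assumption.
    - exists 1; split; [lra |]; intros u s u' s' [Hu0 Hu1] [Hs0 Hs1] [Hu'0 Hu'1] [Hs'0 Hs'1].
      replace (u' * s' - u * s)%R with ((u' - u) * s' + (s' - s) * u)%R by ring.
      eapply Rle_trans; [apply Rabs_triang |]; rewrite !Rabs_mult, (Rabs_right s'), (Rabs_right u) by lra.
      pose proof (Rabs_pos (u' - u)); pose proof (Rabs_pos (s' - s)); nra. }
  apply (rho_family (fun u => concat (concat al (fun s => et (u * s)%R))
                        (rev_path (concat be (fun s => et (u * s)%R))))).
  - assert (Hcat : forall ga, path b C ga -> family T t (fun u => concat ga (fun s => et (u * s)%R))).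
    { intros ga Hga; apply family_concat; [eapply path_family; eauto | exact Hfam |].
      intros u _; rewrite Rmult_0_r, He0; apply Hga. }
    apply family_concat; [| apply family_rev |]; auto.
    intros u _; rewrite rev_path_0, !concat_1; reflexivity.
  - intros u _; rewrite concat_0, concat_1, concat_0, rev_path_1, concat_0.
    split; [apply Hal | apply Hbe].
  - apply concat_ext; [apply concat_ext; auto |].
    + intros s _; rewrite Rmult_0_l, He0; reflexivity.
    + intros s Hs; rewrite rev_concat by (rewrite Rmult_0_r; congruence).
      apply concat_ext; auto; intros s' _; unfold rev_path, const_path; rewrite Rmult_0_l; auto.
  - apply concat_ext; [apply concat_ext; auto | apply rev_ext, concat_ext; auto];
      intros s _; f_equal; ring.
Qed.

(** From here on [holD g0 g1 = e] serves as the working form of homotopy with fixed ends, as far as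
    [rho] can see it. *)
Lemma holD_family (C : set E) (H : R -> R -> set E) (g0 g1 : R -> set E) :
  family T t H -> (forall u, I01 u -> H u 0 = b /\ H u 1 = C) ->
  (forall s, I01 s -> g0 s = H 0 s) -> (forall s, I01 s -> g1 s = H 1 s) ->
  holD g0 g1 = e.
Proof.
  intros HH Hends H0 H1.
  assert (Hg1 : path b C g1).
  { apply (pathK_ext _ _ _ _ (H 1)); [intros; symmetry; auto |].
    apply family_path; auto; apply Hends; auto. }
  rewrite <- (holD_self C g1 Hg1).
  assert (Hr := path_rev _ _ _ _ _ Hg1).
  apply (rho_family (fun u => concat (H u) (rev_path g1))).
  - apply family_concat; [exact HH | eapply path_family; eauto |].
    intros u Hu; destruct (Hends u Hu) as [_ ->]; symmetry; apply Hr.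
  - intros u Hu; rewrite concat_0, concat_1; split; [apply Hends, Hu | apply Hr].
  - apply concat_ext; auto.
  - apply concat_ext; auto.
Qed.

Lemma holD_reparam2 (C : set E) (g g0 g1 : R -> set E) (phi psi : R -> R) (a c : set E) :
  path a c g -> reparam phi -> reparam psi -> phi 0 = psi 0 -> phi 1 = psi 1 ->
  g (phi 0) = b -> g (phi 1) = C ->
  (forall s, I01 s -> g0 s = g (phi s)) -> (forall s, I01 s -> g1 s = g (psi s)) ->
  holD g0 g1 = e.
Proof.
  intros Hg Hphi Hpsi E0 E1 Eb EC H0 H1.
  apply (holD_family C (fun u s => g ((1 - u) * phi s + u * psi s)%R)).
  - eapply family_interpolate; eauto.
  - intros u _; rewrite <- E0, <- E1, <- Eb, <- EC; split; f_equal; ring.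
  - intros s Hs; rewrite H0 by exact Hs; f_equal; ring.
  - intros s Hs; rewrite H1 by exact Hs; f_equal; ring.
Qed.

Lemma holD_replace (C : set E) (al al' be be' : R -> set E) :
  path b C al -> path b C al' -> path b C be -> path b C be' ->
  holD al al' = e -> holD be be' = e -> holD al be = holD al' be'.
Proof.
  intros Hal Hal' Hbe Hbe' Ha Hb'.
  rewrite <- (holD_trans C al al' be), <- (holD_trans C al' be' be), Ha by assumption.
  rewrite <- (holD_inv C be be'), Hb', ginv_one, gone_l, gone_r by assumption; reflexivity.
Qed.

Lemma holD_assoc (C1 C2 C : set E) (al de et : R -> set E) :
  path b C1 al -> path C1 C2 de -> path C2 C et ->
  holD (concat (concat al de) et) (concat al (concat de et)) = e.
Proof.
  intros Hal Hde Het.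
  assert (G1 : al 1 = de 0).
  { destruct Hal as [_ [_ [_ ->]]], Hde as [_ [_ [-> _]]]; reflexivity. }
  assert (G2 : de 1 = et 0).
  { destruct Hde as [_ [_ [_ ->]]], Het as [_ [_ [-> _]]]; reflexivity. }
  assert (G3 : al 1 = concat de et 0) by (rewrite concat_0; exact G1).
  assert (G4 : concat al de 1 = et 0) by (rewrite concat_1; exact G2).
  assert (HQ := path_concat _ _ _ _ _ _ _ Hal (path_concat _ _ _ _ _ _ _ Hde Het)).
  (* [phi] sends the breakpoints 1/4 and 1/2 of the left bracketing to the breakpoints 1/2 and 3/4
     of the right one. *)
  set (phi := fun s => if Rle_dec s (/ 4) then (2 * s)%R else
    if Rle_dec s (/ 2) then (s + / 4)%R else (s / 2 + / 2)%R).
  assert (E0 : phi 0 = 0) by (unfold phi; case_Rle; lra).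
  assert (E1 : phi 1 = 1) by (unfold phi; case_Rle; lra).
  apply (holD_reparam2 C _ _ _ phi (fun s => s) b C HQ); auto.
  - unfold phi; piecewise_reparam 2.
  - apply reparam_id.
  - rewrite E0; apply HQ.
  - rewrite E1; apply HQ.
  - intros s _; unfold phi; destruct (Rle_dec s (/ 4)); [| destruct (Rle_dec s (/ 2))].
    + rewrite (concat_l (concat al de)), (concat_l al de), (concat_l al) by lra; f_equal; ring.
    + rewrite (concat_l (concat al de)), (concat_r al de), (concat_r al), (concat_l de) by (auto; lra).
      f_equal; field.
    + rewrite (concat_r (concat al de)), (concat_r al), (concat_r de) by (auto; lra); f_equal; field.
Qed.

(** Reassociate, contract the loop at the end of [ga], and absorb the remaining constant path by a
    reparametrization. *)
Lemma holD_null (a C : set E) (ga de de' : R -> set E) :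
  path b a ga -> path a C de -> path a C de' ->
  homotopic T t a (concat de (rev_path de')) (fun _ => a) ->
  holD (concat (concat ga de) (rev_path de')) ga = e.
Proof.
  intros Hga Hde Hde' [H [HK [Hc [Hends Ha]]]].
  assert (Hr := path_rev _ _ _ _ _ Hde').
  assert (Hl := path_concat _ _ _ _ _ _ _ Hde Hr).
  assert (Hcst := path_const T t a (pathK_isK_l _ _ _ _ _ Hde)).
  assert (P1 : path b a (concat (concat ga de) (rev_path de'))).
  { eapply path_concat; [eapply path_concat |]; eauto. }
  assert (P2 : path b a (concat ga (concat de (rev_path de')))) by (eapply path_concat; eauto).
  assert (P3 : path b a (concat ga (const_path a))) by (eapply path_concat; eauto).
  rewrite <- (holD_trans a _ (concat ga (concat de (rev_path de')))) by auto.
  rewrite (holD_assoc a C a) by auto; rewrite gone_l.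
  rewrite <- (holD_trans a _ (concat ga (const_path a))) by auto.
  assert (G1 : ga 1 = a) by apply Hga.
  rewrite (holD_family a (fun u => concat ga (H u))).
  - rewrite gone_l.
    set (phi := fun s => if Rle_dec s (/ 2) then (2 * s)%R else 1).
    assert (E0 : phi 0 = 0) by (unfold phi; case_Rle; lra).
    assert (E1 : phi 1 = 1) by (unfold phi; case_Rle; lra).
    apply (holD_reparam2 a ga _ _ phi (fun s => s) b a Hga); auto.
    + unfold phi; piecewise_reparam 2.
    + apply reparam_id.
    + rewrite E0; apply Hga.
    + rewrite E1; exact G1.
    + intros s _; unfold phi; destruct (Rle_dec s (/ 2)).
      * apply concat_l; assumption.
      * rewrite concat_r by (auto; lra); symmetry; exact G1.
  - apply family_concat; [eapply path_family; eauto | split; assumption |].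
    intros u Hu; destruct (Ha u Hu) as [-> _]; exact G1.
  - intros u Hu; rewrite concat_0, concat_1; split; [apply Hga | apply Ha, Hu].
  - apply concat_ext; auto; intros s Hs; symmetry; apply Hends, Hs.
  - apply concat_ext; auto; intros s Hs; symmetry; apply Hends, Hs.
Qed.

(** Appending the reverse of [de'] to both paths changes nothing, by [holD_cancel]; each then
    becomes [ga] followed by a contractible loop. *)
Lemma holD_unique (a C : set E) (ga de de' : R -> set E) :
  path b a ga -> path a C de -> path a C de' ->
  homotopic T t a (concat de (rev_path de')) (fun _ => a) ->
  homotopic T t a (concat de' (rev_path de')) (fun _ => a) ->
  holD (concat ga de) (concat ga de') = e.
Proof.
  intros Hga Hde Hde' Hn Hn'; assert (Hr := path_rev _ _ _ _ _ Hde').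
  rewrite <- (holD_cancel C a _ _ (rev_path de')) by (eauto using path_concat).
  rewrite (holD_replace a _ ga _ ga); eauto using path_concat, holD_null, holD_self.
Qed.

(** Both paths are [g] after parameter maps with the same ends, also when [r' < r] and the second
    one backtracks. *)
Lemma holD_split (c : set E) (g : R -> set E) (r r' : R) : path b c g -> I01 r -> I01 r' ->
  holD (fun s => g (r' * s)%R) (concat (fun s => g (r * s)%R) (fun s => g (r + (r' - r) * s)%R)) = e.
Proof.
  intros Hg [Hr0 Hr1] [Hr'0 Hr'1].
  set (phi := fun s => if Rle_dec s (/ 2) then (r * (2 * s))%R else (r + (r' - r) * (2 * s - 1))%R).
  assert (Hphi : reparam phi).
  { unfold phi; split.
    - intros s [Hs0 Hs1]; unfold I01; case_Rle; nra.
    - exists 2; split; [lra |]; intros s s' [Hs0 Hs1] [Hs'0 Hs'1].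
      assert (Rabs (s - s') = s - s' /\ 0 <= s - s' \/ Rabs (s - s') = s' - s /\ 0 <= s' - s)%R.
      { unfold Rabs; destruct Rcase_abs; [right | left]; lra. }
      apply Rabs_le; case_Rle; destruct H as [[-> H] | [-> H]]; split; nra. }
  assert (E0 : phi 0 = (r' * 0)%R) by (unfold phi; case_Rle; lra).
  assert (E1 : phi 1 = (r' * 1)%R) by (unfold phi; case_Rle; lra).
  apply (holD_reparam2 (g r') g _ _ (fun s => r' * s)%R phi b c Hg); auto.
  - replace (fun s => r' * s)%R with (fun s => r' * s + 0)%R.
    + apply reparam_affine; split; lra.
    + apply functional_extensionality; intro; ring.
  - rewrite Rmult_0_r; apply Hg.
  - f_equal; ring.
  - intros s _; unfold concat, phi; destruct Rle_dec; reflexivity.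
Qed.

Lemma rho_const : rho (const_path b) = e.
Proof.
  rewrite <- (holD_self b (const_path b)) by (apply path_const, Hb).
  unfold holD; change (rev_path (const_path b)) with (const_path b).
  rewrite concat_const; reflexivity.
Qed.

Lemma holD_loop (g : R -> set E) : loopK T t b g -> holD g (const_path b) = rho g.
Proof.
  intro Hg; unfold holD; change (rev_path (const_path b)) with (const_path b).
  destruct Hrho as [_ Hmul]; rewrite Hmul, rho_const by (auto; apply path_const, Hb).
  apply gone_r.
Qed.

End Representation.

(** * The bundle of a representation *)

(* The bundle glued from the trivial one by the coboundary [pot j x * (pot i x)^-1]: its total space
   is [pt * G] as a set, but the charts twist the topology by [pot]. *)
Section Gluing.
Variables (G : Group) (T : tiling_t) (t : R) (I : Type) (c : I -> set pt) (pot : I -> pt -> G).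
Hypotheses (Ht : 0 < t) (Hc : forall i, PE_open T t (c i)) (Hall : forall x, exists i, c i x).
Local Infix "*" := (gmul G).
Local Notation h j i x := (pot j x * ginv G (pot i x)).
Hypothesis HPE : forall i j x y, c i x -> c j x -> c i y -> c j y -> simR T t x y ->
  h j i x = h j i y.
Hypothesis Hloc : forall i j x, c i x -> c j x -> exists d, 0 < d /\
  forall y, c i y -> c j y -> dist x y < d -> h j i y = h j i x.

(** The sheets of chart [i] are the level sets of [pot i y * w]; openness is tested in every
    chart. *)
Definition glued_opn (W : set (pt * G)) : Prop :=
  forall x v, W (x, v) -> forall i, c i x -> exists d, 0 < d /\
    forall y w, c i y -> dist x y < d -> pot i y * w = pot i x * v -> W (y, w).

Lemma glued_chart (i : I) (W : set (pt * G)) : (forall p, W p -> c i (fst p)) ->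
  (glued_opn W <->
   openPG G (fun xg => exists p, W p /\ fst p = fst xg /\ pot i (fst p) * snd p = snd xg)).
Proof.
  intro HW; split.
  - intros Ho g x [[x' v] [Hp [Hx Hg]]]; simpl in *; subst x' g.
    assert (Hi : c i x) by apply (HW _ Hp).
    destruct (Ho x v Hp i Hi) as [d [Hd H]].
    destruct (Hc i) as [Hio _]; destruct (Hio x Hi) as [d' [Hd' H']].
    exists (Rmin d d'); split; [apply Rmin_glb_lt; lra |]; intros y Hy.
    pose proof (Rmin_l d d'); pose proof (Rmin_r d d').
    exists (y, ginv G (pot i y) * (pot i x * v)); simpl.
    rewrite gmulKV; split; [apply H; [apply H'; lra | lra | apply gmulKV] | auto].
  - intros Ho x v Hp j Hj; assert (Hi : c i x) by apply (HW _ Hp).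
    destruct (Ho (pot i x * v) x) as [d [Hd H]]; [exists (x, v); auto |].
    destruct (Hloc j i x Hj Hi) as [d' [Hd' H']].
    destruct (Hc i) as [Hio _]; destruct (Hio x Hi) as [d'' [Hd'' H'']].
    exists (Rmin d (Rmin d' d'')); split; [repeat apply Rmin_glb_lt; lra |]; intros y w Hy Hxy Hw.
    pose proof (Rmin_l d (Rmin d' d'')); pose proof (Rmin_r d (Rmin d' d'')).
    pose proof (Rmin_l d' d''); pose proof (Rmin_r d' d'').
    destruct (H y) as [[y' w'] [HW' [E1 E2]]]; [lra |]; simpl in *; subst y'.
    (* Near [x] the quotient of the two potentials is constant, so the sheets of charts [j] and [i]
       through [(x, v)] coincide there. *)
    assert (E : pot i y * w = pot i x * v).
    { assert (F : h i j y = h i j x) by (apply H'; [exact Hy | apply H''; lra | lra]).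
      rewrite <- (gmulVK G (pot j y) w), Hw, (gassoc G (pot i y)), F, <- gassoc, gmulVK.
      reflexivity. }
    rewrite <- E in E2; apply gmul_cancel_l in E2; subst w'; exact HW'.
Qed.

Definition glued_bundle : FlatPEBundle G T t.
Proof.
  refine {| tot := (pt * G)%type; opn := glued_opn; proj := fst;
            act := fun p g => (fst p, snd p * g); Idx := I; cov := c;
            triv := fun i p => pot i (fst p) * snd p |}.
  - intros x v _ i Hi; exists 1; split; [lra | auto].
  - intros F HF x v [W [HFW HW]] i Hi; destruct (HF W HFW x v HW i Hi) as [d [Hd H]].
    exists d; split; [exact Hd |]; intros; exists W; auto.
  - intros W1 W2 H1 H2 x v [HW1 HW2] i Hi.
    destruct (H1 x v HW1 i Hi) as [d [Hd H]], (H2 x v HW2 i Hi) as [d' [Hd' H']].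
    exists (Rmin d d'); split; [apply Rmin_glb_lt; lra |]; intros y w Hy Hxy Hw.
    pose proof (Rmin_l d d'); pose proof (Rmin_r d d').
    split; [apply H | apply H']; auto; lra.
  - intros [x v]; simpl; rewrite gone_r; reflexivity.
  - intros [x v] g g'; simpl; rewrite gassoc; reflexivity.
  - reflexivity.
  - intros g W HW x v HWp i Hi; simpl in *.
    destruct (HW x (v * g) HWp i Hi) as [d [Hd H]]; exists d; split; [exact Hd |].
    intros y w Hy Hxy Hw; apply H; auto; rewrite !gassoc, Hw; reflexivity.
  - intros U HU x v Hx i Hi; destruct (HU x Hx) as [d [Hd H]]; exists d; split; [exact Hd |].
    intros y w _ Hxy _; apply H, Hxy.
  - exact Ht.
  - exact Hc.
  - exact Hall.
  - intros i [x v] g _; simpl; apply gassoc.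
  - intros i x g _; exists (x, ginv G (pot i x) * g); simpl.
    split; [reflexivity |]; split; [apply gmulKV |]; intros [y w] Hy <-; simpl in *; subst y.
    rewrite gmulVK; reflexivity.
  - apply glued_chart.
  - exists (fun j i x => h j i x); split; [| split; [exact HPE | exact Hloc]].
    intros i j [x v] _ _; simpl; rewrite <- gassoc, gmulVK; reflexivity.
Defined.
End Gluing.

(** * Every representation is a holonomy *)

Section Realization.
Variables (G : Group) (T : tiling_t) (t : R) (x0 : pt) (rho : (R -> set E) -> G).
Hypotheses (Ht : 0 < t) (Hrho : isHom G T t (piK T t x0) rho).
Hypotheses (Hpc : path_connectedK T t) (Hlpc : loc_path_connectedK T t)
  (Hsl : semiloc_simply_connectedK T t).
Local Infix "*" := (gmul G).
Local Notation e := (gone G).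
Local Notation path := (pathK T t).
Local Notation b := (piK T t x0).
Local Notation D := (holD G rho).

(** A path-connected neighbourhood whose loops at the centre [a] contract in K_t, possibly outside
    [W]. *)
Definition good_nbhd (W : set (set E)) (a : set E) : Prop :=
  openK T t W /\ isK T t a /\ W a /\
  (forall C C', isK T t C -> isK T t C' -> W C -> W C' ->
     exists g, path C C' g /\ forall s, I01 s -> W (g s)) /\
  (forall g, loopK T t a g -> (forall s, I01 s -> W (g s)) -> homotopic T t a g (fun _ => a)).

Lemma good_nbhd_exists (a : set E) : isK T t a -> exists W, good_nbhd W a.
Proof.
  intro Ha; destruct (Hsl a Ha) as [V [HV [HVa HVn]]].
  destruct (Hlpc a V Ha HV HVa) as [W [HW [HWa [HWV HWp]]]].
  exists W; repeat split; auto.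
Qed.

Lemma concat_in (W : set (set E)) (g h : R -> set E) :
  (forall s, I01 s -> W (g s)) -> (forall s, I01 s -> W (h s)) ->
  forall s, I01 s -> W (concat g h s).
Proof.
  intros Hg Hh s [Hs0 Hs1]; unfold concat; destruct Rle_dec; [apply Hg | apply Hh]; split; lra.
Qed.

Lemma rev_in (W : set (set E)) (g : R -> set E) :
  (forall s, I01 s -> W (g s)) -> forall s, I01 s -> W (rev_path g s).
Proof. intros Hg s [Hs0 Hs1]; apply Hg; split; lra. Qed.

Lemma good_nbhd_unique (W : set (set E)) (a C : set E) (ga de de' : R -> set E) :
  good_nbhd W a -> path b a ga -> path a C de -> path a C de' ->
  (forall s, I01 s -> W (de s)) -> (forall s, I01 s -> W (de' s)) ->
  D (concat ga de) (concat ga de') = e.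
Proof.
  intros [_ [_ [_ [_ Hnull]]]] Hga Hde Hde' HW HW'.
  apply (holD_unique G T t b rho Hrho a C); auto; apply Hnull;
    try (eapply path_concat; [| apply path_rev]; eassumption);
    apply concat_in; auto; apply rev_in; auto.
Qed.

(** [ga C] is a reference path, chosen without any continuity in [C]; [de i C] stays in chart [i]
    and starts at its centre. Charts are indexed by all good neighbourhoods with their centres. *)
Lemma realization_data : exists (ga : set E -> R -> set E)
  (de : {Wa : set (set E) * set E | good_nbhd (fst Wa) (snd Wa)} -> set E -> R -> set E),
  (forall C, isK T t C -> path b C (ga C)) /\
  (forall i C, isK T t C -> fst (proj1_sig i) C ->
     path (snd (proj1_sig i)) C (de i C) /\ forall s, I01 s -> fst (proj1_sig i) (de i C s)).
Proof.
  destruct (choice_fun (set E) (R -> set E) (fun C g => isK T t C -> path b C g)) as [ga Hga].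
  { intro C; destruct (classic (isK T t C)) as [HC | HC]; [| exists (fun _ => C); tauto].
    destruct (Hpc b C (isK_piK T t x0) HC) as [g Hg]; exists g; auto. }
  set (I := {Wa : set (set E) * set E | good_nbhd (fst Wa) (snd Wa)}).
  destruct (choice_fun (I * set E) (R -> set E) (fun iC g => isK T t (snd iC) ->
    fst (proj1_sig (fst iC)) (snd iC) -> path (snd (proj1_sig (fst iC))) (snd iC) g /\
    forall s, I01 s -> fst (proj1_sig (fst iC)) (g s))) as [de Hde].
  { intros [[[W a] [HW [Ha [HWa [HWp Hn]]]]] C]; simpl in *.
    destruct (classic (isK T t C /\ W C)) as [[HC HWC] | H]; [| exists (fun _ => C); tauto].
    destruct (HWp a C Ha HC HWa HWC) as [g Hg]; exists g; auto. }
  exists ga, (fun i C => de (i, C)); split; [exact Hga |]; intros i C; apply (Hde (i, C)).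
Qed.

Lemma realization : exists B : BasedBundle G T x0, exists HB : brad G T x0 B <= t,
  forall g, loopK T t b g -> hol (bundle_system (bbun G T x0 B) HB) (bpt0 G T x0 B) g (rho g).
Proof.
  destruct realization_data as [ga [de [Hga Hde]]].
  set (I := {Wa : set (set E) * set E | good_nbhd (fst Wa) (snd Wa)}) in *.
  set (W := fun i : I => fst (proj1_sig i)); set (a := fun i : I => snd (proj1_sig i)).
  assert (Hgood : forall i, good_nbhd (W i) (a i)) by (intro i; apply (proj2_sig i)).
  assert (HaK : forall i, isK T t (a i)) by (intro i; apply (Hgood i)).
  assert (HWo : forall i, openK T t (W i)) by (intro i; apply (Hgood i)).
  set (al := fun i C => concat (ga (a i)) (de i C)).
  assert (Hal : forall i C, isK T t C -> W i C -> path b C (al i C)).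
  { intros i C HC HW; eapply path_concat; [apply Hga, HaK | apply Hde; assumption]. }
  (* The path through the centre of chart [i], measured against the reference path. The arbitrary
     [ga] cancels in the transition functions, by [Htrans]. *)
  set (pot := fun i x => D (al i (piK T t x)) (ga (piK T t x))).
  set (cv := fun i x => W i (piK T t x)).
  (* Within chart [i], continuing the path to [C] by [et] is as good as the chosen path to [C'];
     here the contractibility of loops at the centre enters. *)
  assert (Hmove : forall i C C' et, isK T t C -> isK T t C' -> path C C' et ->
    (forall s, I01 s -> W i (et s)) -> D (al i C') (concat (al i C) et) = e).
  { intros i C C' et HC HC' Het HWet.
    assert (HW0 : W i C) by (destruct Het as [_ [_ [<- _]]]; auto).
    assert (HW1 : W i C') by (destruct Het as [_ [_ [_ <-]]]; auto).
    destruct (Hde i C HC HW0) as [Hd Hdin], (Hde i C' HC' HW1) as [Hd' Hdin'].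
    assert (Hg := Hga (a i) (HaK i)); unfold al.
    rewrite <- (holD_trans G T t b rho Hrho C' _ (concat (ga (a i)) (concat (de i C) et)))
      by (eauto using path_concat).
    rewrite (good_nbhd_unique (W i) (a i) C' (ga (a i)) (de i C') (concat (de i C) et));
      auto; [| eapply path_concat; eauto | apply concat_in; assumption].
    rewrite <- (holD_inv G T t b rho Hrho C') by (eauto using path_concat).
    rewrite (holD_assoc G T t b rho Hrho (a i) C C') by auto.
    rewrite ginv_one, gone_l; reflexivity. }
  assert (Htrans : forall i j x, cv i x -> cv j x ->
    pot j x * ginv G (pot i x) = D (al j (piK T t x)) (al i (piK T t x))).
  { intros i j x Hi Hj; pose proof (isK_piK T t x) as HK; unfold pot.
    rewrite (holD_inv G T t b rho Hrho (piK T t x)) by auto.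
    apply (holD_trans G T t b rho Hrho (piK T t x)); auto. }
  assert (Hcv : forall i, PE_open T t (cv i)).
  { intro i; split; [apply openK_openR2, HWo |]; intros x y Hx Hxy; unfold cv.
    apply piK_eq in Hxy; rewrite <- Hxy; exact Hx. }
  assert (Hall : forall x, exists i, cv i x).
  { intro x; destruct (good_nbhd_exists (piK T t x) (isK_piK T t x)) as [V HV].
    exists (exist _ (V, piK T t x) HV); apply HV. }
  assert (HPE : forall i j x y, cv i x -> cv j x -> cv i y -> cv j y -> simR T t x y ->
    pot j x * ginv G (pot i x) = pot j y * ginv G (pot i y)).
  { intros i j x y _ _ _ _ Hxy; apply piK_eq in Hxy; unfold pot; rewrite Hxy; reflexivity. }
  assert (Hloc : forall i j x, cv i x -> cv j x -> exists d, 0 < d /\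
    forall y, cv i y -> cv j y -> dist x y < d ->
      pot j y * ginv G (pot i y) = pot j x * ginv G (pot i x)).
  { intros i j x Hi Hj; pose proof (isK_piK T t x) as HK.
    destruct (Hlpc _ _ HK (openK_inter T t _ _ (HWo i) (HWo j)) (conj Hi Hj))
      as [V [HV [HVx [HVsub HVp]]]].
    destruct (openK_openR2 T t V HV x HVx) as [d [Hd H]].
    exists d; split; [exact Hd |]; intros y Hyi Hyj Hxy; rewrite !Htrans by auto.
    pose proof (isK_piK T t y) as HK'.
    destruct (HVp _ _ HK HK' HVx (H y Hxy)) as [et [Het Hetin]].
    (* The paths to [y] in both charts are replaced by the paths to [x] with the common tail [et],
       which cancels. *)
    rewrite (holD_replace G T t b rho Hrho (piK T t y) _ (concat (al j (piK T t x)) et)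
      _ (concat (al i (piK T t x)) et)); eauto using path_concat.
    - apply (holD_cancel G T t b rho Hrho (piK T t x) (piK T t y)); auto.
    - apply Hmove; auto; intros; apply HVsub; auto.
    - apply Hmove; auto; intros; apply HVsub; auto. }
  set (bb := glued_bundle G T t I cv pot Ht Hcv Hall HPE Hloc).
  assert (Hcb := path_const T t b (isK_piK T t x0)).
  assert (Hgb := Hga b (isK_piK T t x0)).
  (* Fibre coordinates are relative to [ga b], which need not be the constant path; this element is
     the constant path in those coordinates. *)
  set (p0 := (x0, D (ga b) (const_path b)) : tot bb).
  exists {| brad := t; bbun := bb; bpt0 := p0; bpt0_fib := eq_refl |}; simpl.
  exists (Rle_refl t); intros g Hg.
  set (L := bundle_system bb (Rle_refl t)).
  destruct (lift_exists G T t L b b g p0 Hg eq_refl) as [l [Hl Hl0]].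
  assert (Hpr : forall s, I01 s -> piK T t (fst (l s)) = g s).
  { intros s Hs; apply (lift_pr _ _ _ L g l s Hl Hs). }
  (* [F] compares the lift with the transport by [rho] along the initial segments of [g]; it is locally constant. *)
  set (F := fun s => D (fun r => g (s * r)%R) (ga (g s)) * snd (l s)).
  assert (Hhead : forall s, I01 s -> path b (g s) (fun r => g (s * r)%R)).
  { intros s Hs; assert (H := path_tail T t b b g 0 s Hg I01_0 Hs).
    replace (g 0) with b in H by (symmetry; apply Hg).
    eapply pathK_ext; [| exact H]; intros r _; cbv beta; f_equal; ring. }
  assert (HKg : forall s, I01 s -> isK T t (g s)) by apply Hg.
  assert (HF : forall i s s', I01 s -> I01 s' ->
    (forall r, I01 r -> W i (g (s + (s' - s) * r)%R)) ->
    ls_tv L i (l s) = ls_tv L i (l s') -> F s = F s').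
  { intros i s s' Hs Hs' Hin Htv; simpl in Htv; unfold pot in Htv; rewrite !Hpr in Htv by auto.
    assert (HWs : W i (g s)).
    { specialize (Hin 0 I01_0); rewrite Rmult_0_r, Rplus_0_r in Hin; exact Hin. }
    assert (HWs' : W i (g s')).
    { specialize (Hin 1 I01_1); rewrite Rmult_1_r in Hin.
      replace (s + (s' - s))%R with s' in Hin by ring; exact Hin. }
    (* Inserting the path of chart [i] writes [F] as a relative transport times the chart value of
       the lift. The second factor is unchanged by hypothesis, the first by [Hmove] and cancellation
       of the common tail. *)
    assert (HFs : forall r, I01 r -> W i (g r) ->
      F r = D (fun q => g (r * q)%R) (al i (g r)) * (D (al i (g r)) (ga (g r)) * snd (l r))).
    { intros r Hr HWr; rewrite gassoc, (holD_trans G T t b rho Hrho (g r)); auto. }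
    rewrite !HFs, Htv by auto; f_equal; symmetry.
    assert (Htail := path_tail T t b b g s s' Hg Hs Hs').
    rewrite (holD_replace G T t b rho Hrho (g s') _
      (concat (fun r => g (s * r)%R) (fun r => g (s + (s' - s) * r)%R))
      _ (concat (al i (g s)) (fun r => g (s + (s' - s) * r)%R)));
      try (eapply path_concat; [| exact Htail]); auto.
    - apply (holD_cancel G T t b rho Hrho (g s) (g s')); auto.
    - apply (holD_split G T t b rho Hrho b); auto. }
  assert (HF01 : F 0 = F 1).
  { symmetry; refine (I01_connected (fun s => F s = F 0) _ 0 1 I01_0 I01_1 eq_refl).
    intros s Hs; destruct (Hl s Hs) as [_ Hls].
    destruct (ls_all _ _ _ L (g s) (HKg s Hs)) as [i Hi].
    destruct (Hls i Hi) as [d [Hd H]]; exists d; split; [exact Hd |]; intros s' Hs' Hsd.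
    rewrite (HF i s s'); [tauto | exact Hs | exact Hs' | | symmetry; apply H; assumption].
    intros r [Hr0 Hr1]; destruct Hs, Hs'; apply Rabs_lt_iff in Hsd.
    assert (Hr : I01 (s + (s' - s) * r)) by (split; nra).
    destruct (H (s + (s' - s) * r)%R) as [Hc _]; [exact Hr | apply Rabs_lt_iff; nra |].
    rewrite <- (Hpr _ Hr) in Hc |- *; apply (imK_piK T t (cv i) (Hcv i)), Hc. }
  assert (Hg0 : g 0 = b) by apply Hg.
  assert (Hg1 : g 1 = b) by apply Hg.
  (* Here [F 0] becomes [e], so [snd (l 1)] is the inverse of [D g (ga b)]; composing with the
     transport from [g] to the constant path gives [rho g]. *)
  unfold F in HF01; rewrite Hl0, Hg0, Hg1 in HF01; simpl in HF01.
  rewrite (holD_ext G T t b rho Hrho b (const_path b) (fun r => g (0 * r)%R) (ga b) (ga b)) in HF01; auto;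
    [| intros s _; rewrite Rmult_0_l; exact Hg0].
  rewrite (holD_ext G T t b rho Hrho b g (fun r => g (1 * r)%R) (ga b) (ga b)) in HF01; auto;
    [| intros s _; rewrite Rmult_1_l; reflexivity].
  rewrite (holD_trans G T t b rho Hrho b), (holD_self G T t b rho Hrho b) in HF01 by auto.
  exists l; split; [exact Hl |]; split; [rewrite Hl0; apply fib_rel_refl |].
  split; [simpl; rewrite Hpr by auto; exact Hg1 |]; intros i _; simpl.
  assert (Hp1 : piK T t (fst (l 1)) = b) by (rewrite Hpr; auto).
  unfold pot; rewrite Hp1, <- gassoc; f_equal.
  apply (gmul_cancel_l G (D g (ga b))).
  rewrite (gassoc G _ (snd (l 1))), <- HF01, gone_l, (holD_trans G T t b rho Hrho b) by auto.
  apply holD_loop with (T := T) (t := t) (b := b); auto; apply isK_piK.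
Qed.
End Realization.

(** * Classification *)

(** The bijection is expressed on representatives, without forming quotients: the equivalence
    contains well-definedness and injectivity on classes, the last clause surjectivity. *)
Theorem mainTheorem2 (G : Group) (T : tiling_t) (x0 : pt) (t : nat -> R)
  (HT : is_tiling T) (Hflc : FLC T) (Hmin : minimal_hull T)
  (HK : forall r, 0 < r ->
     path_connectedK T r /\ loc_path_connectedK T r /\ semiloc_simply_connectedK T r)
  (Ht0 : 0 < t 0%nat) (Hmono : forall n, t n <= t (S n))
  (Hinf : forall M, exists N, forall n, (N <= n)%nat -> M <= t n) :
  exists Phi : BasedBundle G T x0 -> DLrep G T x0 t,
    (forall B1 B2, bundle_equiv G T x0 B1 B2 <-> dl_equiv G T x0 t (Phi B1) (Phi B2)) /\
    (forall r, exists B, dl_equiv G T x0 t (Phi B) r).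
Proof.
  assert (Hpos : forall n, 0 < t n).
  { intro n; apply Rlt_le_trans with (t 0%nat); [exact Ht0 |]; apply radii_le; [exact Hmono | lia]. }
  assert (Hle : forall B (r : DLrep G T x0 t) k, brad G T x0 B <= t (dl_index G T x0 t r) ->
    (dl_index G T x0 t r <= k)%nat -> brad G T x0 B <= t k).
  { intros B r k HB Hk; eapply Rle_trans; [exact HB | apply radii_le; assumption]. }
  (* The index chosen for [B] is not canonical. What is recorded is independent of it: pulled back
     to any later level, the homomorphism is the holonomy of [B] there. *)
  destruct (choice_fun (BasedBundle G T x0) (DLrep G T x0 t) (fun B r =>
    brad G T x0 B <= t (dl_index G T x0 t r) /\
    forall k (Hk : brad G T x0 B <= t k) g a, (dl_index G T x0 t r <= k)%nat ->
      loopK T (t k) (bpt T x0 t k) g ->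
      (hol (bundle_system (bbun G T x0 B) Hk) (bpt0 G T x0 B) g a <->
       dl_hom G T x0 t r (fun s => fmap T t (dl_index G T x0 t r) (k - dl_index G T x0 t r) (g s)) = a)))
    as [Phi HPhi].
  { intro B; destruct (Hinf (brad G T x0 B)) as [n Hn].
    assert (HB : brad G T x0 B <= t n) by (apply Hn; lia).
    destruct (hol_isHom _ _ _ (bundle_system (bbun G T x0 B) HB) (bpt0 G T x0 B)) as [rho [Hrho Hhol]].
    simpl in Hrho, Hhol; rewrite bpt0_fib in Hrho, Hhol.
    exists (existT _ n (exist _ rho Hrho)); split; [exact HB |]; simpl.
    intros k Hk g a Hnk Hg.
    assert (Hg' := fmap_path T t Hmono n k _ _ g Hnk Hg).
    unfold bpt in Hg'; rewrite fmap_piK in Hg' by assumption.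
    specialize (Hhol _ Hg'); split; [intro Ha | intros <-].
    - apply (bundle_hol_fmap G T x0 t Hmono B n k HB Hk g a Hnk) in Ha.
      eapply hol_unique; eassumption.
    - destruct (hol_exists _ _ _ (bundle_system (bbun G T x0 B) Hk) (bpt0 G T x0 B) g) as [a Ha].
      { simpl; rewrite bpt0_fib; exact Hg. }
      assert (Ha' := bundle_hol_fmap G T x0 t Hmono B n k HB Hk g a Hnk Ha).
      cbn in *; rewrite (hol_unique _ _ _ _ _ _ _ _ Hhol Ha'); exact Ha. }
  exists Phi; split.
  - intros B1 B2; destruct (HPhi B1) as [HB1 H1], (HPhi B2) as [HB2 H2]; split.
    + intros [s [Hs1 [Hs2 Hiso]]]; destruct (Hinf s) as [N HN].
      (* Level [k] lies beyond both indices, and its radius is at least [s], so that the isomorphism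
         preserves holonomy there. *)
      set (k := Nat.max N (Nat.max (dl_index G T x0 t (Phi B1)) (dl_index G T x0 t (Phi B2)))).
      assert (Hk1 : (dl_index G T x0 t (Phi B1) <= k)%nat) by lia.
      assert (Hk2 : (dl_index G T x0 t (Phi B2) <= k)%nat) by lia.
      exists k; split; [exact Hk1 |]; split; [exact Hk2 |]; intros g Hg; symmetry.
      apply (H2 k (Hle _ _ _ HB2 Hk2) g _ Hk2 Hg).
      apply (based_iso_hol G T x0 B1 B2 (t k) (Hle _ _ _ HB1 Hk1) (Hle _ _ _ HB2 Hk2) s);
        [apply HN; lia | exact Hiso | exact Hg |].
      apply (H1 k (Hle _ _ _ HB1 Hk1) g _ Hk1 Hg); reflexivity.
    + intros [k [Hk1 [Hk2 Hk]]].
      exists (t k); split; [exact (Hle _ _ _ HB1 Hk1) |]; split; [exact (Hle _ _ _ HB2 Hk2) |].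
      apply (hol_based_iso G T x0 B1 B2 (t k) (Hle _ _ _ HB1 Hk1) (Hle _ _ _ HB2 Hk2));
        try apply HK, Hpos.
      intros g a Hg; rewrite H1, H2, (Hk g Hg) by assumption; reflexivity.
  - intros [n [rho Hrho]]; destruct (HK (t n) (Hpos n)) as [Hpc [Hlpc Hsl]].
    destruct (realization G T (t n) x0 rho (Hpos n) Hrho Hpc Hlpc Hsl) as [B [HB Hhol]].
    exists B; destruct (HPhi B) as [HB' H].
    (* [Phi B] may sit at an index other than [n]; the two homomorphisms are compared at a level
       beyond both, where each is the holonomy of [B]. *)
    set (k := Nat.max n (dl_index G T x0 t (Phi B))).
    assert (Hk : (dl_index G T x0 t (Phi B) <= k)%nat) by lia.
    assert (Hnk : (n <= k)%nat) by lia.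
    exists k; split; [exact Hk |]; split; [exact Hnk |]; intros g Hg; simpl.
    apply (H k (Hle _ _ _ HB' Hk) g _ Hk Hg).
    destruct (hol_exists _ _ _ (bundle_system (bbun G T x0 B) (Hle _ _ _ HB' Hk)) (bpt0 G T x0 B) g)
      as [a Ha]; [simpl; rewrite bpt0_fib; exact Hg |].
    assert (Ha' := bundle_hol_fmap G T x0 t Hmono B n k HB _ g a Hnk Ha).
    assert (Hg' := fmap_path T t Hmono n k _ _ g Hnk Hg).
    unfold bpt in Hg'; rewrite fmap_piK in Hg' by assumption.
    refine (eq_ind a (fun v => hol _ _ g v) Ha _ _).
    exact (eq_sym (hol_unique _ _ _ _ _ _ _ _ (Hhol _ Hg') Ha')).
Qed.
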